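(* Given $t,\lambda$ ($0<t<\pi/2$, $\lambda\in\mathbb{R}$), let $f$ denote the solution of $\mathcal{S}_f=R_{t,\lambda}$ in the unit disk $\mathbb{D}$ normalized by $J_f(0)=(0,1,0)$. Suppose that the image $f(\mathbb{D})$ is a pregear. Let $q=-f^{-1}(b^-)$ or $q=-f^{-1}(b^+)$, where the pregear center $b^-\in\mathbb{R}$ or $b^+\in\mathbb{R}$ of $D=f(\mathbb{D})$ is as described in the context. Then the solution $h$ of the Schwarzian differential equation $$\mathcal{S}_h=(R_{t,\lambda}\circ T_q)\,(T_q')^2$$ normalized by the 2-jet $$J_h(0)=\left(0,\ \frac{1-q^2}{b^+-b^-}f'(-q),\ \frac{\pm2(1-q^2)^2}{(b^+-b^-)^2}f'(-q)^2+\frac{1-q^2}{b^+-b^-}\left((1-q^2)f''(-q)+2q f'(-q)\right)\right),$$ where the sign $\pm$ is $-$ when the pregear center is $b^-$ and $+$ when it is $b^+$, is a gear (not only a pregear) mapping satisfying $h(0)=0$, $h'(0)>0$.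
   Context: The Schwarzian derivative is $\mathcal{S}_f=(f''/f')'-\frac12(f''/f')^2$; the 2-jet of $f$ at $z$ is $J_f(z)=(f(z),f'(z),f''(z))$. For $-1<q<1$, $T_q(z)=\frac{z-q}{1-qz}$. $R_{t,\lambda}$ is the rational function with $\frac12R_{t,\lambda}=\psi_{0,t}-\lambda\psi_{1,t}$, where $$\psi_{0,t}(z)=\frac{(\sin^2t)\left(z^4-(16\cos t)z^3+(4+2\cos 2t)z^2-(16\cos t)z+1\right)}{2\left(z^4-(2\cos 2t)z^2+1\right)^2},\qquad \psi_{1,t}(z)=\frac{-8\cos t}{z^4-(2\cos 2t)z^2+1}.$$ Gears and pregears: a one-tooth gear domain (gear) is a topological quadrilateral which is the union of an open disk and a sector of a concentric disk of larger radius; up to an affine map $az+b$ it is the domain $G_{\beta,\gamma}$ ($\beta>1$, $0<\gamma<\pi$) with vertices $\beta e^{\pm i\gamma}$, $e^{\pm i\gamma}$, whose tooth edges are the straight segments $[\beta e^{i\gamma},e^{i\gamma}]$ and $[e^{-i\gamma},\beta e^{-i\gamma}]$ and whose other edges are arcs of $\{|w|=1\}$ ($\gamma<\arg w<2\pi-\gamma$) and $\{|w|=\beta\}$ ($-\gamma<\arg w<\gamma$). A pregear is the image of a gear under a Möbius transformation; its tooth edges are those corresponding to the tooth edges of the gear. A (pre)gear mapping is a conformal mapping of $\mathbb{D}$ onto a (pre)gear. The pregear center: let $D$ be a pregear symmetric in $\mathbb{R}$, with no vertices on $\mathbb{R}$, which is not a gear. Let $p_{-1}<p_1$ be the extreme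 points of the real interval $D\cap\mathbb{R}$, let $\rho$ be the common radius of the circles containing the tooth edges, and let $c$ be the center of the circle containing a tooth edge. Put $d=(\rho^2-(\mathrm{Im}\,c)^2)^{1/2}$ and $b^\pm=\mathrm{Re}\,c\pm d$ (the intersection points of the two circles containing the tooth edges). Precisely one of $b^-,b^+$ is interior to $D$, i.e. lies between $p_{-1}$ and $p_1$; that one is the pregear center.
   Formalization: The sign ± in the third entry of J_h(0) is corrected: it is + when the pregear center is b^- and − when it is b^+; with the printed sign the second intersection point of the tooth circles is not sent to infinity, so h is not a gear mapping. *)

(* Defs.v *)
From Stdlib Require Export Reals.
From Coquelicot Require Export Coquelicot.
Open Scope R_scope.

Definition disk (z : C) : Prop := Cmod z < 1.

Definition image (phi : C -> C) (A : C -> Prop) (w : C) : Prop :=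
  exists z : C, A z /\ w = phi z.

Definition same_set (A B : C -> Prop) : Prop := forall w : C, A w <-> B w.

(** * Schwarzian derivative and Schwarzian differential equation *)

Definition schwarzian (f : C -> C) (z : C) : C :=
  (C_derive (fun w => C_derive (C_derive f) w / C_derive f w) z
   - / 2 * (C_derive (C_derive f) z / C_derive f z) ^ 2)%C.

Definition jet2 (f : C -> C) (z : C) : C * C * C :=
  (f z, C_derive f z, C_derive (C_derive f) z).

(** [C_derive] is total, so the derivatives occurring in the equation are
    required to exist, and [f'] not to vanish.  Values at poles are not
    represented: a solution is holomorphic on the disk. *)
Definition schwarzian_solution (Q f : C -> C) : Prop :=
  forall z : C, disk z ->
    ex_derive f z /\
    ex_derive (C_derive f) z /\
    ex_derive (C_derive (C_derive f)) z /\
    C_derive f z <> 0%C /\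
    schwarzian f z = Q z.

Definition psi0 (t : R) (z : C) : C :=
  (RtoC (sin t ^ 2)
   * (z ^ 4 - RtoC (16 * cos t) * z ^ 3 + RtoC (4 + 2 * cos (2 * t)) * z ^ 2
      - RtoC (16 * cos t) * z + 1)
   / (2 * (z ^ 4 - RtoC (2 * cos (2 * t)) * z ^ 2 + 1) ^ 2))%C.

Definition psi1 (t : R) (z : C) : C :=
  (RtoC (- 8 * cos t) / (z ^ 4 - RtoC (2 * cos (2 * t)) * z ^ 2 + 1))%C.

Definition Rtl (t lam : R) (z : C) : C :=
  (2 * (psi0 t z - RtoC lam * psi1 t z))%C.

Definition Tq (q : R) (z : C) : C := ((z - RtoC q) / (1 - RtoC q * z))%C.

Definition pullback_Tq (q : R) (Q : C -> C) (z : C) : C :=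
  (Q (Tq q z) * C_derive (Tq q) z ^ 2)%C.

(** * Gears and pregears *)

Definition polar (r theta : R) : C := (r * cos theta, r * sin theta).

(** The domain $G_{\beta,\gamma}$. *)
Definition std_gear (beta gamma : R) (w : C) : Prop :=
  Cmod w < 1 \/
  exists r theta : R,
    0 < r < beta /\ - gamma < theta < gamma /\ w = polar r theta.

(** The segment of the ray of argument [theta] between the circles of radii
    [1] and [beta]; it is a tooth edge of the gear for [theta = gamma] and
    [theta = - gamma], and its end points are vertices. *)
Definition std_tooth_edge (beta theta : R) (w : C) : Prop :=
  exists r : R, 1 <= r <= beta /\ w = polar r theta.

Definition std_vertex (beta gamma : R) (w : C) : Prop :=
  exists r theta : R,
    (r = 1 \/ r = beta) /\ (theta = gamma \/ theta = - gamma) /\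
    w = polar r theta.

Record gear_chart := {
  gc_beta : R;
  gc_gamma : R;
  gc_a : C;
  gc_b : C;
  gc_beta_gt1 : 1 < gc_beta;
  gc_gamma_range : 0 < gc_gamma < PI;
  gc_a_neq0 : gc_a <> 0%C
}.

Definition gear_map (g : gear_chart) (w : C) : C := (gc_a g * w + gc_b g)%C.

Definition gear_set (g : gear_chart) : C -> Prop :=
  image (gear_map g) (std_gear (gc_beta g) (gc_gamma g)).

Definition is_gear (D : C -> Prop) : Prop :=
  exists g : gear_chart, same_set D (gear_set g).

(** A gear together with a Moebius transformation $(Az+B)/(Cz+D)$ without
    pole in the gear. *)
Record pregear_chart := {
  pc_gear : gear_chart;
  pc_A : C;
  pc_B : C;
  pc_C : C;
  pc_D : C;
  pc_det : (pc_A * pc_D - pc_B * pc_C)%C <> 0%C;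
  pc_regular : forall w : C, gear_set pc_gear w -> (pc_C * w + pc_D)%C <> 0%C
}.

Definition pc_moebius (P : pregear_chart) (w : C) : C :=
  ((pc_A P * w + pc_B P) / (pc_C P * w + pc_D P))%C.

Definition pregear_set (P : pregear_chart) : C -> Prop :=
  image (pc_moebius P) (gear_set (pc_gear P)).

Definition is_pregear (D : C -> Prop) : Prop :=
  exists P : pregear_chart, same_set D (pregear_set P).

(** Finite part of the image in the pregear of a subset [E] of the closure of
    the standard gear: the Moebius transformation may have a pole on the
    boundary. *)
Definition pc_image (P : pregear_chart) (E : C -> Prop) (w : C) : Prop :=
  exists u : C, E u /\
    (pc_C P * gear_map (pc_gear P) u + pc_D P)%C <> 0%C /\
    w = pc_moebius P (gear_map (pc_gear P) u).

Definition pregear_vertex (D : C -> Prop) (v : C) : Prop :=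
  exists P : pregear_chart, same_set D (pregear_set P) /\
    pc_image P (std_vertex (gc_beta (pc_gear P)) (gc_gamma (pc_gear P))) v.

(** The circle of center [c] and radius [rho] contains a tooth edge of [D]. *)
Definition tooth_circle (D : C -> Prop) (c : C) (rho : R) : Prop :=
  0 < rho /\
  exists (P : pregear_chart) (theta : R),
    same_set D (pregear_set P) /\
    (theta = gc_gamma (pc_gear P) \/ theta = - gc_gamma (pc_gear P)) /\
    forall w : C,
      pc_image P (std_tooth_edge (gc_beta (pc_gear P)) theta) w ->
      Cmod (w - c)%C = rho.

(** [bpm c rho false] and [bpm c rho true] are $b^-$ and $b^+$. *)
Definition bpm (c : C) (rho : R) (plus : bool) : R :=
  let d := sqrt (rho ^ 2 - Im c ^ 2) in
  if plus then Re c + d else Re c - d.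

(** [D] is a pregear to which the definition of the pregear center applies,
    with tooth circle [c], [rho], and its center is [bpm c rho plus]. *)
Definition pregear_center
    (D : C -> Prop) (c : C) (rho : R) (plus : bool) : Prop :=
  is_pregear D /\
  (forall w : C, D w <-> D (Cconj w)) /\
  (forall v : C, pregear_vertex D v -> Im v <> 0) /\
  ~ is_gear D /\
  tooth_circle D c rho /\
  exists pm1 p1 : R,
    pm1 < p1 /\
    (forall x : R, D (RtoC x) <-> pm1 < x < p1) /\
    pm1 < bpm c rho plus < p1.

(** * Conformal mappings *)

Definition conformal_onto (f : C -> C) (D : C -> Prop) : Prop :=
  (forall z : C, disk z -> ex_derive f z) /\
  (forall z w : C, disk z -> disk w -> f z = f w -> z = w) /\
  same_set (image f disk) D.

Definition gear_mapping (h : C -> C) : Prop :=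
  exists D : C -> Prop, is_gear D /\ conformal_onto h D.

(** The 2-jet prescribed for [h].  Its third entry is the second derivative at
    [0] of $L\circ f\circ T_q$, where $L(w) = (w-b^-)/(b^+-w)$ if the center is
    $b^-$ and $L(w) = (w-b^+)/(w-b^-)$ if it is $b^+$; this fixes the sign of
    the first summand, since $L'' = \pm 2/(b^+-b^-)^2$ at the center, with $+$
    for $b^-$ and $-$ for $b^+$. *)
Definition gear_jet (f : C -> C) (bm bp q : R) (plus : bool) : C * C * C :=
  let k := RtoC ((1 - q ^ 2) / (bp - bm)) in
  let f1 := C_derive f (RtoC (- q)) in
  let f2 := C_derive (C_derive f) (RtoC (- q)) in
  let sgn := RtoC (if plus then -1 else 1) in
  (RtoC 0,
   (k * f1)%C,
   (sgn * 2 * RtoC ((1 - q ^ 2) ^ 2 / (bp - bm) ^ 2) * f1 ^ 2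
    + k * (RtoC (1 - q ^ 2) * f2 + RtoC (2 * q) * f1))%C).

(* Main.v *)
Require Import Defs.
From Stdlib Require Import Lra Lia Classical Ranalysis5.

(** Let [b0] be the pregear center and [b1] the other intersection point of the
    tooth circles, and let [L] be the Moebius transformation
    [(w - b0)/(w - b1)] if the center is [b+] and [(w - b0)/(b1 - w)] if it is
    [b-]; it sends [b0] to the origin and [b1] to infinity.  The proof identifies
    [h] with [L o f o T_q] and [L (D)] with a gear.

    Write [D] as the image of the standard gear [G] under a Moebius
    transformation [M].  As [D] is symmetric, [M] conjugates complex conjugation
    to an anti-Moebius automorphism of [G], whose composition with conjugation
    is a Moebius automorphism.  Such an automorphism fixes the origin and
    infinity ([gear_automorphism]): it maps the boundary of [G] to itself, the
    boundary lies on the circles [|w| = 1], [|w| = beta] and two lines through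
    the origin, so by the pigeonhole principle each of the two circles has three
    boundary points, hence all its points, mapped to one of these four curves;
    comparison of coefficients excludes the lines and leaves [w -> k w].
    Therefore [M 0] and [M oo] are real.  They also lie on each circle containing
    a tooth edge, since this edge is the image of a segment of a ray from the
    origin ([tooth_circle_points]); so they are [b-] and [b+].  As the center
    belongs to [D] and [M oo] does not, the center is [M 0]
    ([pregear_center_mobius]).  Then [L o M] fixes the origin and infinity, so it
    is a multiplication, and [L (D)] is a gear.

    On the analytic side, a solution of the Schwarzian equation is determined by
    its 2-jet at the origin ([solves_unique]).  Since the right-hand side and the
    initial jet of [f] are real, [f] commutes with conjugation; so the preimage
    of the real center is real, which gives [q], and [f'] is positive on
    [(-1, 1)].  By the chain rule ([solves_mobius_comp]) [L o f o T_q] solves the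
    transformed equation, and its 2-jet at the origin is the prescribed one. *)

(** * Complex derivatives *)

(** Complex differentiability, with all data typed in [C]. *)
Definition is_Cderive (f : C -> C) (z l : C) : Prop :=
  @is_derive C_AbsRing C_NormedModule f z l.

Lemma is_Cderive_eps (f : C -> C) (z l : C) :
  is_Cderive f z l <->
  forall eps : R, 0 < eps -> exists delta : R, 0 < delta /\
    forall y : C, Cmod (y - z)%C < delta ->
      Cmod (f y - f z - (y - z) * l)%C <= eps * Cmod (y - z)%C.
Proof.
  split.
  - intros [_ H] eps He.
    destruct (H z (fun P HP => HP) (mkposreal eps He)) as [[d Hd] Hy].
    exists d; split; [exact Hd|].
    intros y Hyd. exact (Hy y Hyd).
  - intros H. split.
    + exact (is_linear_scal_l (K := C_AbsRing) (V := C_NormedModule) l).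
    + intros x Hx.
      assert (E : z = x) by exact (is_filter_lim_locally_unique
        (K := C_AbsRing) (V := AbsRing_NormedModule C_AbsRing) z x Hx).
      subst x.
      intros [eps He]. destruct (H eps He) as [d [Hd Hy]].
      exists (mkposreal d Hd). intros y Hyd. exact (Hy y Hyd).
Qed.

(** The two normed module structures of [C] over itself give the same notion. *)
Lemma is_Cderive_AbsRing (f : C -> C) (z l : C) :
  is_Cderive f z l <->
  @is_derive C_AbsRing (AbsRing_NormedModule C_AbsRing) f z l.
Proof.
  split; intros [_ H]; split.
  - exact (is_linear_scal_l (K := C_AbsRing) (V := AbsRing_NormedModule C_AbsRing) l).
  - exact H.
  - exact (is_linear_scal_l (K := C_AbsRing) (V := C_NormedModule) l).
  - exact H.
Qed.

Lemma is_Cderive_const (a z : C) : is_Cderive (fun _ => a) z 0%C.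
Proof. exact (is_derive_const (K := C_AbsRing) (V := C_NormedModule) a z). Qed.

Lemma is_Cderive_id (z : C) : is_Cderive (fun w => w) z 1%C.
Proof. apply is_Cderive_AbsRing. exact (is_derive_id (K := C_AbsRing) z). Qed.

Lemma is_Cderive_plus (f g : C -> C) (z a b : C) :
  is_Cderive f z a -> is_Cderive g z b ->
  is_Cderive (fun w => f w + g w)%C z (a + b)%C.
Proof. exact (is_derive_plus (K := C_AbsRing) (V := C_NormedModule) f g z a b). Qed.

Lemma is_Cderive_mult (f g : C -> C) (z a b : C) :
  is_Cderive f z a -> is_Cderive g z b ->
  is_Cderive (fun w => f w * g w)%C z (a * g z + f z * b)%C.
Proof.
  rewrite !is_Cderive_AbsRing. intros Hf Hg.
  exact (is_derive_mult (K := C_AbsRing) f g z a b Hf Hg Cmult_comm).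
Qed.

Lemma is_Cderive_comp (f g : C -> C) (z a b : C) :
  is_Cderive f (g z) a -> is_Cderive g z b ->
  is_Cderive (fun w => f (g w)) z (b * a)%C.
Proof.
  rewrite (is_Cderive_AbsRing g). intros Hf Hg.
  exact (is_derive_comp (K := C_AbsRing) (V := C_NormedModule) f g z a b Hf Hg).
Qed.

Lemma is_Cderive_eq (f : C -> C) (z a b : C) :
  is_Cderive f z a -> a = b -> is_Cderive f z b.
Proof. now intros H <-. Qed.

Lemma is_Cderive_Cinv (z : C) :
  z <> 0%C -> is_Cderive Cinv z (- / (z * z))%C.
Proof.
  intros Hz. apply is_Cderive_eps. intros eps He.
  assert (Hm : 0 < Cmod z) by now apply Cmod_gt_0.
  set (m := Cmod z) in *.
  assert (He3 : 0 < eps * m ^ 3 / 2) by (apply Rdiv_lt_0_compat; [apply Rmult_lt_0_compat; [|apply pow_lt]|]; lra).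
  exists (Rmin (m / 2) (eps * m ^ 3 / 2)). split.
  { apply Rmin_glb_lt; lra. }
  intros y Hy.
  assert (Hy1 : Cmod (y - z)%C < m / 2) by (eapply Rlt_le_trans; [exact Hy|apply Rmin_l]).
  assert (Hy2 : Cmod (y - z)%C < eps * m ^ 3 / 2) by (eapply Rlt_le_trans; [exact Hy|apply Rmin_r]).
  assert (Hym : m / 2 <= Cmod y).
  { assert (m <= Cmod y + Cmod (y - z)%C); [|lra].
    unfold m. replace z with (y + - (y - z))%C at 1 by ring.
    rewrite <- (Cmod_opp (y - z)). apply Cmod_triangle. }
  assert (Hy0 : y <> 0%C) by (apply Cmod_gt_0; lra).
  replace (/ y - / z - (y - z) * - / (z * z))%C
    with ((y - z) * ((y - z) * (/ y * / (z * z))))%C by (field; auto).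
  rewrite 2!Cmod_mult, Cmod_mult, !Cmod_inv, Cmod_mult by (auto using Cmult_neq_0).
  fold m. rewrite Rmult_comm. apply Rmult_le_compat_r; [apply Cmod_ge_0|].
  assert (Hi : / Cmod y <= 2 / m).
  { replace (2 / m) with (/ (m / 2)) by (field; lra). apply Rinv_le_contravar; lra. }
  assert (0 < / Cmod y) by (apply Rinv_0_lt_compat; lra).
  assert (Hmm : 0 < / (m * m)) by (apply Rinv_0_lt_compat; nra).
  apply Rle_trans with (eps * m ^ 3 / 2 * (2 / m * / (m * m))).
  - apply Rmult_le_compat; [apply Cmod_ge_0| |lra|].
    + apply Rmult_le_pos; lra.
    + apply Rmult_le_compat_r; lra.
  - right. field. lra.
Qed.

Lemma is_Cderive_div (f g : C -> C) (z a b : C) :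
  is_Cderive f z a -> is_Cderive g z b -> g z <> 0%C ->
  is_Cderive (fun w => f w / g w)%C z ((a * g z - f z * b) / (g z * g z))%C.
Proof.
  intros Hf Hg Hz.
  eapply is_Cderive_eq.
  - apply is_Cderive_mult; [exact Hf|].
    apply (is_Cderive_comp Cinv g); [apply is_Cderive_Cinv; exact Hz|exact Hg].
  - cbv beta. field. exact Hz.
Qed.

Lemma is_Cderive_minus (f g : C -> C) (z a b : C) :
  is_Cderive f z a -> is_Cderive g z b ->
  is_Cderive (fun w => f w - g w)%C z (a - b)%C.
Proof. exact (is_derive_minus (K := C_AbsRing) (V := C_NormedModule) f g z a b). Qed.

Lemma is_Cderive_Cconj (f : C -> C) (z l : C) :
  is_Cderive f (Cconj z) l ->
  is_Cderive (fun w => Cconj (f (Cconj w))) z (Cconj l).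
Proof.
  rewrite !is_Cderive_eps. intros H eps He.
  destruct (H eps He) as [d [Hd Hy]]. exists d; split; [exact Hd|].
  intros y Hyd.
  assert (E : Cmod (Cconj y - Cconj z)%C = Cmod (y - z)%C).
  { now rewrite <- Cminus_conj, Cmod_conj. }
  specialize (Hy (Cconj y)). rewrite E in Hy. specialize (Hy Hyd).
  rewrite <- Cmod_conj in Hy. rewrite !Cminus_conj, Cmult_conj, Cminus_conj, !Cconj_conj in Hy.
  exact Hy.
Qed.

Lemma disk_open (z : C) : disk z ->
  exists d : R, 0 < d /\ forall y : C, Cmod (y - z)%C < d -> disk y.
Proof.
  unfold disk. intros Hz. exists (1 - Cmod z). split; [lra|].
  intros y Hy. replace y with ((y - z) + z)%C by ring.
  eapply Rle_lt_trans; [apply Cmod_triangle|lra].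
Qed.

Lemma is_Cderive_ext_disk (f g : C -> C) (z l : C) :
  (forall w, disk w -> f w = g w) -> disk z ->
  is_Cderive f z l -> is_Cderive g z l.
Proof.
  intros E Hz. apply is_derive_ext_loc.
  destruct (disk_open z Hz) as [d [Hd H]].
  exists (mkposreal d Hd). intros y Hy. apply E, H, Hy.
Qed.

Lemma is_derive_of_bound (u : R -> R) (s l : R) :
  (forall eps, 0 < eps -> exists d, 0 < d /\ forall y, Rabs (y - s) < d ->
     Rabs (u y - u s - (y - s) * l) <= eps * Rabs (y - s)) ->
  is_derive u s l.
Proof.
  intros K. apply is_derive_Reals. intros eps He.
  destruct (K (eps / 2)) as [d [Hd Hy]]; [lra|].
  exists (mkposreal d Hd). intros h Hh0 Hh. simpl in Hh.
  specialize (Hy (s + h)). replace (s + h - s) with h in Hy by ring.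
  specialize (Hy Hh).
  replace ((u (s + h) - u s) / h - l) with ((u (s + h) - u s - h * l) / h)
    by (field; exact Hh0).
  unfold Rdiv. rewrite Rabs_mult, Rabs_inv.
  assert (0 < Rabs h) by now apply Rabs_pos_lt.
  apply Rmult_lt_reg_r with (Rabs h); [assumption|].
  rewrite Rmult_assoc, Rinv_l, Rmult_1_r by lra.
  apply Rle_lt_trans with (eps / 2 * Rabs h); [exact Hy|nra].
Qed.

(** Restriction of a holomorphic function to the line [z + x v], [x] real. *)
Lemma is_derive_along (F : C -> C) (z v : C) (s : R) (l : C) :
  is_Cderive F (z + RtoC s * v)%C l ->
  is_derive (fun x : R => Re (F (z + RtoC x * v)%C)) s (Re (v * l)%C) /\
  is_derive (fun x : R => Im (F (z + RtoC x * v)%C)) s (Im (v * l)%C).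
Proof.
  rewrite is_Cderive_eps. intros H.
  assert (K : forall eps, 0 < eps -> exists d, 0 < d /\ forall y, Rabs (y - s) < d ->
    Cmod (F (z + RtoC y * v) - F (z + RtoC s * v) - RtoC (y - s) * (v * l))%C
      <= eps * Rabs (y - s)).
  { intros eps He. assert (Hv := Cmod_ge_0 v).
    destruct (H (eps / (Cmod v + 1))) as [d [Hd Hy]]; [apply Rdiv_lt_0_compat; lra|].
    exists (d / (Cmod v + 1)). split; [apply Rdiv_lt_0_compat; lra|].
    intros y Hys.
    assert (E : Cmod (z + RtoC y * v - (z + RtoC s * v))%C = Rabs (y - s) * Cmod v).
    { replace (z + RtoC y * v - (z + RtoC s * v))%C with (RtoC (y - s) * v)%C
        by (rewrite RtoC_minus; ring).
      now rewrite Cmod_mult, Cmod_R. }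
    specialize (Hy (z + RtoC y * v)%C). rewrite E in Hy.
    assert (Ha := Rabs_pos (y - s)).
    replace (z + RtoC y * v - (z + RtoC s * v))%C with (RtoC (y - s) * v)%C in Hy
        by (rewrite RtoC_minus; ring).
    rewrite Cmult_assoc.
    eapply Rle_trans; [apply Hy|].
    - apply Rle_lt_trans with (Rabs (y - s) * (Cmod v + 1)); [nra|].
      apply (Rmult_lt_compat_r (Cmod v + 1)) in Hys; [|lra].
      replace (d / (Cmod v + 1) * (Cmod v + 1)) with d in Hys by (field; lra). exact Hys.
    - unfold Rdiv. replace (eps * / (Cmod v + 1) * (Rabs (y - s) * Cmod v))
        with (eps * Rabs (y - s) * (Cmod v * / (Cmod v + 1))) by ring.
      rewrite <- (Rmult_1_r (eps * Rabs (y - s))) at 2.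
      apply Rmult_le_compat_l; [nra|].
      apply Rmult_le_reg_r with (Cmod v + 1); [lra|].
      rewrite Rmult_assoc, Rinv_l by lra. lra. }
  split; apply is_derive_of_bound; intros eps He; destruct (K eps He) as [d [Hd Hy]];
    exists d; (split; [exact Hd|]); intros y Hys; specialize (Hy y Hys);
    (eapply Rle_trans; [|exact Hy]).
  - eapply Rle_trans; [|apply re_le_Cmod]. right. f_equal.
    unfold Re, Im; simpl; ring.
  - eapply Rle_trans; [|apply (Rle_trans _ _ _ (Rmax_r _ _) (Rmax_Cmod _))]. right. f_equal.
    unfold Re, Im; simpl; ring.
Qed.

Lemma constant_of_zero_derive (u : R -> R) :
  (forall s, 0 <= s <= 1 -> is_derive u s 0) -> u 1 = u 0.
Proof.
  intros H.
  destruct (MVT_gen u 0 1 (fun _ => 0)) as [x [_ E]].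
  - intros s. rewrite Rmin_left, Rmax_right by lra. intros Hs. apply H. lra.
  - intros s. rewrite Rmin_left, Rmax_right by lra. intros Hs.
    apply derivable_continuous_pt. exists 0. apply is_derive_Reals, H. lra.
  - lra.
Qed.

(** Reduces to the real case by restriction to the segment from the origin. *)
Lemma zero_derive_disk (F : C -> C) :
  (forall z, disk z -> is_Cderive F z 0%C) ->
  forall z, disk z -> F z = F 0%C.
Proof.
  intros H z Hz.
  assert (Hs : forall s, 0 <= s <= 1 -> is_Cderive F (0 + RtoC s * z)%C 0%C).
  { intros s Hs. apply H. unfold disk in *.
    rewrite Cplus_0_l, Cmod_mult, Cmod_R, Rabs_pos_eq by lra.
    assert (X := Cmod_ge_0 z). nra. }
  assert (E1 : (0 + RtoC 1 * z)%C = z) by ring.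
  assert (E0 : (0 + RtoC 0 * z)%C = 0%C) by ring.
  assert (ER := constant_of_zero_derive (fun x => Re (F (0 + RtoC x * z)%C))).
  assert (EI := constant_of_zero_derive (fun x => Im (F (0 + RtoC x * z)%C))).
  cbv beta in ER, EI. rewrite E1, E0 in ER, EI.
  apply injective_projections; [apply ER|apply EI]; intros s Hs0;
    destruct (is_derive_along F 0 z s 0 (Hs s Hs0)) as [A B];
    rewrite Cmult_0_r in A, B; assumption.
Qed.

(** * The Schwarzian equation *)

(** On [S], the functions [f1], [f2], [f3] are the successive derivatives of
    [f]. *)
Definition jet3_on (S : C -> Prop) (f f1 f2 f3 : C -> C) : Prop :=
  forall z : C, S z ->
    is_Cderive f z (f1 z) /\ is_Cderive f1 z (f2 z) /\ is_Cderive f2 z (f3 z).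

(** The Schwarzian derivative as a function of the values of [f'], [f''],
    [f''']. *)
Definition schw (a1 a2 a3 : C) : C :=
  ((a3 * a1 - a2 * a2) / (a1 * a1) - / 2 * (a2 / a1) ^ 2)%C.

(** [f] solves the Schwarzian equation with right-hand side [Q] in the disk, and
    [f1], [f2], [f3] are its derivatives there. *)
Definition solves (Q f f1 f2 f3 : C -> C) : Prop :=
  jet3_on disk f f1 f2 f3 /\
  forall z : C, disk z -> f1 z <> 0%C /\ schw (f1 z) (f2 z) (f3 z) = Q z.

Lemma ex_derive_C_derive (f : C -> C) (z : C) :
  ex_derive f z -> is_Cderive f z (C_derive f z).
Proof. intros H. exact (C_derive_correct f z 0%C H). Qed.

Lemma is_Cderive_unique (f : C -> C) (z l : C) :
  is_Cderive f z l -> C_derive f z = l.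
Proof. exact (is_C_derive_unique f z l). Qed.

Lemma schwarzian_solution_solves (Q f : C -> C) :
  schwarzian_solution Q f ->
  solves Q f (C_derive f) (C_derive (C_derive f)) (C_derive (C_derive (C_derive f))).
Proof.
  intros H. split.
  - intros z Hz. destruct (H z Hz) as (H1 & H2 & H3 & _).
    auto using ex_derive_C_derive.
  - intros z Hz. destruct (H z Hz) as (H1 & H2 & H3 & H4 & H5).
    split; [exact H4|]. rewrite <- H5. unfold schw, schwarzian. f_equal.
    symmetry. apply is_Cderive_unique.
    apply is_Cderive_div; auto using ex_derive_C_derive.
Qed.

Lemma solves_schwarzian_solution (Q f f1 f2 f3 : C -> C) :
  solves Q f f1 f2 f3 ->
  schwarzian_solution Q f /\
  forall z, disk z -> C_derive f z = f1 z /\ C_derive (C_derive f) z = f2 z.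
Proof.
  intros [HJ HS].
  assert (E1 : forall z, disk z -> C_derive f z = f1 z).
  { intros z Hz. apply is_Cderive_unique. now apply HJ. }
  assert (D2 : forall z, disk z -> is_Cderive (C_derive f) z (f2 z)).
  { intros z Hz. apply is_Cderive_ext_disk with f1; auto.
    - intros w Hw. now rewrite E1.
    - now apply HJ. }
  assert (E2 : forall z, disk z -> C_derive (C_derive f) z = f2 z).
  { intros z Hz. apply is_Cderive_unique. auto. }
  assert (D3 : forall z, disk z -> is_Cderive (C_derive (C_derive f)) z (f3 z)).
  { intros z Hz. apply is_Cderive_ext_disk with f2; auto.
    - intros w Hw. now rewrite E2.
    - now apply HJ. }
  split; [|auto]. intros z Hz. destruct (HS z Hz) as [H0 HQ].
  split; [|split; [|split; [|split]]].
  - exists (f1 z). now apply HJ.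
  - exists (f2 z). now apply D2.
  - exists (f3 z). now apply D3.
  - now rewrite E1.
  - rewrite <- HQ. unfold schwarzian, schw. rewrite E1, E2 by exact Hz. f_equal.
    apply is_Cderive_unique.
    rewrite <- !(E1 z Hz), <- (E2 z Hz) at 1.
    eapply is_Cderive_eq; [apply is_Cderive_div|].
    + apply D3, Hz.
    + apply D2, Hz.
    + now rewrite E1.
    + rewrite E1, E2 by exact Hz. reflexivity.
Qed.

(** With [p = f''/f'] and [r = g''/g'], the equations [p' = p^2/2 + Q] and
    [r' = r^2/2 + Q] make [(p - r)^2 / (f' g')] constant, so [p = r]; then
    [f'/g'] and [f - g] are constant in turn. *)
Lemma solves_unique (Q f f1 f2 f3 g g1 g2 g3 : C -> C) :
  solves Q f f1 f2 f3 -> solves Q g g1 g2 g3 ->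
  f 0%C = g 0%C -> f1 0%C = g1 0%C -> f2 0%C = g2 0%C ->
  forall z, disk z -> f z = g z /\ f1 z = g1 z.
Proof.
  intros [HJf HSf] [HJg HSg] E0 E1 E2.
  assert (Hd0 : disk 0%C) by (unfold disk; rewrite Cmod_0; lra).
  assert (Hp : forall z, disk z ->
    is_Cderive (fun z => f2 z / f1 z)%C z (Q z + / 2 * (f2 z / f1 z) ^ 2)%C).
  { intros z Hz. destruct (HJf z Hz) as (A & B & D). destruct (HSf z Hz) as [N <-].
    eapply is_Cderive_eq; [apply is_Cderive_div; eassumption|]. unfold schw. ring. }
  assert (Hr : forall z, disk z ->
    is_Cderive (fun z => g2 z / g1 z)%C z (Q z + / 2 * (g2 z / g1 z) ^ 2)%C).
  { intros z Hz. destruct (HJg z Hz) as (A & B & D). destruct (HSg z Hz) as [N <-].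
    eapply is_Cderive_eq; [apply is_Cderive_div; eassumption|]. unfold schw. ring. }
  set (w := fun z => (f2 z / f1 z - g2 z / g1 z)%C).
  assert (Hw : forall z, disk z -> w z = 0%C).
  { assert (Z := zero_derive_disk (fun z => (w z * w z) / (f1 z * g1 z))%C).
    intros z Hz.
    assert (Hc : (w z * w z / (f1 z * g1 z))%C = 0%C).
    { rewrite Z; [|clear z Hz; intros z Hz|exact Hz].
      - unfold w. rewrite E1, E2. unfold Cminus. rewrite Cplus_opp_r. unfold Cdiv. ring.
      - destruct (HSf z Hz) as [Nf _]. destruct (HSg z Hz) as [Ng _].
        destruct (HJf z Hz) as (_ & Bf & _). destruct (HJg z Hz) as (_ & Bg & _).
        assert (Hwz : is_Cderive w z (/ 2 * (f2 z / f1 z) ^ 2 - / 2 * (g2 z / g1 z) ^ 2)%C).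
        { eapply is_Cderive_eq; [apply is_Cderive_minus; [now apply Hp|now apply Hr]|]. ring. }
        eapply is_Cderive_eq.
        + apply is_Cderive_div.
          * apply is_Cderive_mult; exact Hwz.
          * apply is_Cderive_mult; [exact Bf|exact Bg].
          * now apply Cmult_neq_0.
        + unfold w. field. auto. }
    destruct (HSf z Hz) as [Nf _]. destruct (HSg z Hz) as [Ng _].
    assert (Hww : (w z * w z)%C = 0%C).
    { replace (w z * w z)%C with ((w z * w z / (f1 z * g1 z)) * (f1 z * g1 z))%C
        by (field; auto). rewrite Hc. ring. }
    destruct (Ceq_dec (w z) 0) as [|Hn]; [assumption|].
    now destruct (Cmult_neq_0 _ _ Hn Hn). }
  assert (HE1 : forall z, disk z -> f1 z = g1 z).
  { intros z Hz.
    assert (Hq : (f1 z / g1 z)%C = 1%C).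
    { rewrite (zero_derive_disk (fun z => f1 z / g1 z)%C); [| |exact Hz].
      - rewrite E1. field. now apply HSg.
      - clear z Hz. intros z Hz.
        destruct (HSf z Hz) as [Nf _]. destruct (HSg z Hz) as [Ng _].
        destruct (HJf z Hz) as (_ & Bf & _). destruct (HJg z Hz) as (_ & Bg & _).
        eapply is_Cderive_eq; [apply is_Cderive_div; eassumption|].
        transitivity (f1 z / g1 z * w z)%C; [unfold w; field; auto|].
        rewrite Hw by exact Hz. ring. }
    destruct (HSg z Hz) as [Ng _].
    replace (f1 z) with (f1 z / g1 z * g1 z)%C by (field; exact Ng). rewrite Hq. ring. }
  intros z Hz. split; [|auto].
  assert (H : (f z - g z)%C = (f 0 - g 0)%C).
  { apply (zero_derive_disk (fun z => f z - g z)%C); [|exact Hz].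
    clear z Hz. intros z Hz.
    destruct (HJf z Hz) as (Af & _). destruct (HJg z Hz) as (Ag & _).
    eapply is_Cderive_eq; [apply (is_Cderive_minus _ _ _ _ _ Af Ag)|].
    rewrite HE1 by exact Hz. ring. }
  replace (f z) with (f z - g z + g z)%C by ring. rewrite H, E0. ring.
Qed.

Lemma Cdiv_neq_0 (x y : C) : x <> 0%C -> y <> 0%C -> (x / y)%C <> 0%C.
Proof.
  intros Hx Hy E. apply Hx. replace x with (x / y * y)%C by (field; exact Hy).
  rewrite E. ring.
Qed.

Lemma jet3_on_comp (S S' : C -> Prop) (f f1 f2 f3 g g1 g2 g3 : C -> C) :
  jet3_on S' f f1 f2 f3 -> jet3_on S g g1 g2 g3 -> (forall z, S z -> S' (g z)) ->
  jet3_on S (fun z => f (g z)) (fun z => f1 (g z) * g1 z)%C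
    (fun z => f2 (g z) * (g1 z * g1 z) + f1 (g z) * g2 z)%C
    (fun z => f3 (g z) * (g1 z * g1 z * g1 z) + 3 * (f2 (g z) * g1 z * g2 z)
              + f1 (g z) * g3 z)%C.
Proof.
  intros Hf Hg HS z Hz. destruct (Hg z Hz) as (A & B & D).
  destruct (Hf _ (HS z Hz)) as (A' & B' & D').
  assert (K := is_Cderive_comp f g z _ _ A' A).
  assert (K1 := is_Cderive_comp f1 g z _ _ B' A).
  assert (K2 := is_Cderive_comp f2 g z _ _ D' A).
  split; [|split].
  - eapply is_Cderive_eq; [exact K|ring].
  - eapply is_Cderive_eq; [apply is_Cderive_mult; [exact K1|exact B]|]. cbv beta. ring.
  - eapply is_Cderive_eq; [apply is_Cderive_plus; apply is_Cderive_mult;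
      [exact K2|apply is_Cderive_mult; exact B|exact K1|exact D]|]. cbv beta. ring.
Qed.

(** The Moebius transformation [w -> (a w + b)/(c w + d)]. *)
Definition mobius (a b c d w : C) : C := ((a * w + b) / (c * w + d))%C.

Lemma is_Cderive_affine (c d z : C) : is_Cderive (fun w => c * w + d)%C z c.
Proof.
  eapply is_Cderive_eq.
  - apply is_Cderive_plus; [apply is_Cderive_mult; [apply is_Cderive_const|apply is_Cderive_id]
      |apply is_Cderive_const].
  - cbv beta. ring.
Qed.

Lemma mobius_jet3 (a b c d : C) :
  jet3_on (fun w => (c * w + d)%C <> 0%C) (mobius a b c d)
    (fun w => (a * d - b * c) / ((c * w + d) * (c * w + d)))%C
    (fun w => - 2 * c * (a * d - b * c) / ((c * w + d) * (c * w + d) * (c * w + d)))%C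
    (fun w => 6 * (c * c) * (a * d - b * c)
       / ((c * w + d) * (c * w + d) * ((c * w + d) * (c * w + d))))%C.
Proof.
  intros w Hw. assert (K := is_Cderive_affine c d w).
  split; [|split].
  - eapply is_Cderive_eq; [apply is_Cderive_div; [apply is_Cderive_affine|exact K|exact Hw]|].
    cbv beta. field. exact Hw.
  - eapply is_Cderive_eq.
    + apply is_Cderive_div; [apply is_Cderive_const|apply is_Cderive_mult; exact K|].
      now apply Cmult_neq_0.
    + cbv beta. field. exact Hw.
  - eapply is_Cderive_eq.
    + apply is_Cderive_div; [apply is_Cderive_const
        |apply is_Cderive_mult; [apply is_Cderive_mult|]; exact K|].
      now repeat apply Cmult_neq_0.
    + cbv beta. field. exact Hw.
Qed.

(** The Schwarzian chain rule for [L o f o T], with [L] and [T] Moebius: both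
    have zero Schwarzian, so only the pull-back by [T] changes the equation. *)
Lemma solves_mobius_comp (Q f f1 f2 f3 : C -> C) (a b c d a' b' c' d' : C) :
  solves Q f f1 f2 f3 ->
  (a * d - b * c)%C <> 0%C -> (a' * d' - b' * c')%C <> 0%C ->
  (forall z, disk z -> (c * f z + d)%C <> 0%C) ->
  (forall z, disk z -> (c' * z + d')%C <> 0%C) ->
  (forall z, disk z -> disk (mobius a' b' c' d' z)) ->
  exists h3 : C -> C,
  solves (fun z => Q (mobius a' b' c' d' z)
            * ((a' * d' - b' * c') / ((c' * z + d') * (c' * z + d'))) ^ 2)%C
    (fun z => mobius a b c d (f (mobius a' b' c' d' z)))
    (fun z => let T := mobius a' b' c' d' z in
       let T1 := ((a' * d' - b' * c') / ((c' * z + d') * (c' * z + d')))%C in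
       (a * d - b * c) / ((c * f T + d) * (c * f T + d)) * (f1 T * T1))%C
    (fun z => let T := mobius a' b' c' d' z in
       let T1 := ((a' * d' - b' * c') / ((c' * z + d') * (c' * z + d')))%C in
       let T2 := (- 2 * c' * (a' * d' - b' * c')
          / ((c' * z + d') * (c' * z + d') * (c' * z + d')))%C in
       - 2 * c * (a * d - b * c) / ((c * f T + d) * (c * f T + d) * (c * f T + d))
         * ((f1 T * T1) * (f1 T * T1))
       + (a * d - b * c) / ((c * f T + d) * (c * f T + d))
         * (f2 T * (T1 * T1) + f1 T * T2))%C
    h3.
Proof.
  intros [HJ HS] Hdet Hdet' Hpole Hpole' Hdisk.
  assert (JT : jet3_on disk (mobius a' b' c' d') _ _ _)
    by (intros z Hz; exact (mobius_jet3 a' b' c' d' z (Hpole' z Hz))).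
  assert (JfT := jet3_on_comp _ _ _ _ _ _ _ _ _ _ HJ JT Hdisk).
  assert (JL := jet3_on_comp _ _ _ _ _ _ _ _ _ _ (mobius_jet3 a b c d) JfT
    (fun z Hz => Hpole _ (Hdisk z Hz))).
  eexists. split; [exact JL|].
  intros z Hz. specialize (Hpole _ (Hdisk z Hz)). specialize (Hpole' z Hz).
  destruct (HS _ (Hdisk z Hz)) as [N <-]. clear HJ HS JT JfT JL.
  cbv beta zeta. set (T := mobius a' b' c' d' z) in *.
  set (u := (c * f T + d)%C) in *. set (v := (c' * z + d')%C) in *.
  set (e := (a * d - b * c)%C) in *. set (e' := (a' * d' - b' * c')%C) in *.
  split.
  - assert (Hu : (u * u)%C <> 0%C) by now apply Cmult_neq_0.
    assert (Hv : (v * v)%C <> 0%C) by now apply Cmult_neq_0.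
    apply Cmult_neq_0; [now apply Cdiv_neq_0|].
    apply Cmult_neq_0; [exact N|now apply Cdiv_neq_0].
  - unfold schw. match goal with |- @eq _ ?x ?y => change (@eq C x y) end.
    field. repeat split; assumption.
Qed.

Lemma RtoC_conj (x : R) : Cconj (RtoC x) = RtoC x.
Proof. apply injective_projections; simpl; ring. Qed.

Lemma Cinv_conj_total (z : C) : Cconj (/ z) = (/ Cconj z)%C.
Proof.
  unfold Cconj, Cinv; simpl. f_equal.
  - f_equal. f_equal. ring.
  - unfold Rdiv. rewrite <- Ropp_mult_distr_l_reverse. f_equal. f_equal. ring.
Qed.

#[local] Hint Rewrite Cmult_conj Cminus_conj Cplus_conj Cinv_conj_total Cpow_conj
  RtoC_conj : conj.

Lemma solves_Cconj (Q f f1 f2 f3 : C -> C) :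
  (forall z, Q (Cconj z) = Cconj (Q z)) ->
  solves Q f f1 f2 f3 ->
  solves Q (fun z => Cconj (f (Cconj z))) (fun z => Cconj (f1 (Cconj z)))
    (fun z => Cconj (f2 (Cconj z))) (fun z => Cconj (f3 (Cconj z))).
Proof.
  intros HQ [HJ HS].
  assert (Hd : forall z, disk z -> disk (Cconj z))
    by (intros z; unfold disk; now rewrite Cmod_conj).
  split.
  - intros z Hz. destruct (HJ _ (Hd z Hz)) as (A & B & D).
    auto using is_Cderive_Cconj.
  - intros z Hz. destruct (HS _ (Hd z Hz)) as [N E].
    assert (N' : Cconj (f1 (Cconj z)) <> 0%C).
    { apply Cmod_gt_0. rewrite Cmod_conj. now apply Cmod_gt_0. }
    split; [exact N'|].
    replace (Q z) with (Cconj (Q (Cconj z))) by (rewrite HQ; apply Cconj_conj).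
    rewrite <- E. unfold schw, Cdiv. now autorewrite with conj.
Qed.

Lemma Rtl_conj (t lam : R) (z : C) : Rtl t lam (Cconj z) = Cconj (Rtl t lam z).
Proof.
  unfold Rtl, psi0, psi1, Cdiv. now autorewrite with conj.
Qed.

(** * The standard gear and its boundary *)

Lemma Cmod_polar (r theta : R) : 0 <= r -> Cmod (polar r theta) = r.
Proof.
  intros Hr. unfold Cmod, polar. simpl.
  replace (r * cos theta * (r * cos theta * 1) + r * sin theta * (r * sin theta * 1))
    with (r * r * (Rsqr (sin theta) + Rsqr (cos theta))) by (unfold Rsqr; ring).
  rewrite sin2_cos2, Rmult_1_r. now apply sqrt_square.
Qed.

(** The sector [|arg w| < gamma], punctured at the origin, is given by
    [Re w > |w| cos gamma]. *)
Lemma std_gear_iff (beta gamma : R) (w : C) : 0 < gamma < PI ->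
  std_gear beta gamma w <->
  Cmod w < 1 \/ (Cmod w < beta /\ Cmod w * cos gamma < Re w).
Proof.
  intros Hg. split; (intros [H|H]; [now left|right]).
  - destruct H as (r & th & Hr & Hth & ->).
    rewrite Cmod_polar by lra. split; [lra|].
    apply Rmult_lt_compat_l; [lra|].
    destruct (Rle_lt_dec 0 th).
    + apply cos_decreasing_1; lra.
    + rewrite <- (cos_neg th). apply cos_decreasing_1; lra.
  - destruct H as [H1 H2].
    assert (Hm : 0 < Cmod w).
    { apply Cmod_gt_0. intros ->. rewrite Cmod_0 in H2. simpl in H2. lra. }
    assert (Hle := re_le_Cmod w). apply Rabs_le_between in Hle.
    set (m := Cmod w) in *.
    assert (Hc : -1 <= Re w / m <= 1).
    { split; apply Rmult_le_reg_r with m; try exact Hm;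
        unfold Rdiv; rewrite Rmult_assoc, Rinv_l by lra; lra. }
    assert (Hcos := cos_acos _ Hc). assert (Hsin := sin_acos _ Hc).
    assert (Hb := acos_bound (Re w / m)).
    set (th := acos (Re w / m)) in *.
    assert (Hth : th < gamma).
    { apply cos_decreasing_0; try lra. rewrite Hcos.
      apply Rmult_lt_reg_r with m; [exact Hm|].
      unfold Rdiv; rewrite Rmult_assoc, Rinv_l by lra. lra. }
    assert (HS : m * sin th = Rabs (Im w)).
    { rewrite Hsin. rewrite <- (sqrt_square m) at 1 by lra.
      rewrite <- sqrt_mult_alt by nra.
      rewrite <- sqrt_Rsqr_abs. f_equal.
      replace (m * m * (1 - Rsqr (Re w / m))) with (m ^ 2 - Re w ^ 2)
        by (unfold Rsqr; field; lra).
      unfold m. rewrite Cmod2_alt. unfold Rsqr. ring. }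
    assert (HC : m * cos th = Re w) by (rewrite Hcos; field; lra).
    destruct (Rle_lt_dec 0 (Im w)) as [Hi|Hi].
    + exists m, th. split; [lra|]. split; [lra|].
      rewrite Rabs_pos_eq in HS by exact Hi.
      apply injective_projections; simpl; [rewrite HC|rewrite HS]; reflexivity.
    + exists m, (- th). split; [lra|]. split; [lra|].
      rewrite Rabs_left in HS by exact Hi.
      apply injective_projections; simpl; rewrite ?cos_neg, ?sin_neg; [rewrite HC; reflexivity|].
      unfold Im in HS. lra.
Qed.

(** The closure of the standard gear. *)
Definition closed_gear (beta gamma : R) (w : C) : Prop :=
  Cmod w <= 1 \/ (Cmod w <= beta /\ Cmod w * cos gamma <= Re w).

Lemma Cmod_diff_le (z w : C) : Rabs (Cmod z - Cmod w) <= Cmod (z - w)%C.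
Proof.
  apply Rabs_le. split.
  - assert (H := Cmod_triangle z (- (z - w))%C). rewrite Cmod_opp in H.
    replace (z + - (z - w))%C with w in H by ring. lra.
  - assert (H := Cmod_triangle w (z - w)%C).
    replace (w + (z - w))%C with z in H by ring. lra.
Qed.

Lemma closed_gear_limit (beta gamma : R) (w : C) : 0 < gamma < PI ->
  (forall eps, 0 < eps -> exists w', std_gear beta gamma w' /\ Cmod (w' - w)%C < eps) ->
  closed_gear beta gamma w.
Proof.
  intros Hg H.
  destruct (Rle_lt_dec (Cmod w) 1) as [H1|H1]; [now left|].
  assert (Hc := COS_bound gamma).
  assert (K : forall eps, 0 < eps -> eps <= Cmod w - 1 ->
    exists w', Cmod w' < beta /\ Cmod w' * cos gamma < Re w' /\
      Cmod w - eps < Cmod w' < Cmod w + eps /\ Rabs (Re w' - Re w) < eps).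
  { intros eps He1 He2. destruct (H eps He1) as (w' & Hw' & Hd).
    assert (Hm := Cmod_diff_le w' w).
    assert (Hm' : Rabs (Cmod w' - Cmod w) < eps) by lra.
    apply Rabs_lt_between in Hm'.
    apply (std_gear_iff beta gamma w' Hg) in Hw'. exists w'.
    destruct Hw' as [Hw'|[Hw1 Hw2]]; [lra|]. repeat split; try lra.
    apply Rle_lt_trans with (Cmod (w' - w)%C); [|exact Hd].
    replace (Re w' - Re w) with (Re (w' - w)%C) by (unfold Re; simpl; ring).
    apply re_le_Cmod. }
  right. split.
  - apply Rnot_lt_le. intros Hb.
    destruct (K (Rmin (Cmod w - 1) (Cmod w - beta))) as (w' & A & _ & B & _).
    + apply Rmin_glb_lt; lra.
    + apply Rmin_l.
    + assert (X := Rmin_r (Cmod w - 1) (Cmod w - beta)). lra.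
  - apply Rnot_lt_le. intros Hb.
    destruct (K (Rmin (Cmod w - 1) ((Cmod w * cos gamma - Re w) / 2)))
      as (w' & _ & A & B & D).
    + apply Rmin_glb_lt; lra.
    + apply Rmin_l.
    + assert (X := Rmin_r (Cmod w - 1) ((Cmod w * cos gamma - Re w) / 2)).
      apply Rabs_lt_between in D.
      set (e := Rmin _ _) in *.
      assert (Y : Rabs ((Cmod w' - Cmod w) * cos gamma) <= e).
      { rewrite Rabs_mult. rewrite <- (Rmult_1_r e).
        apply Rmult_le_compat; try apply Rabs_pos; apply Rabs_le; lra. }
      apply Rabs_le_between in Y. lra.
Qed.

(** The boundary of the gear lies on the union of two circles and of the two
    lines [Im (w e^(-i gamma)) = 0] and [Im (w e^(i gamma)) = 0]. *)
Lemma closed_gear_boundary (beta gamma : R) (w : C) : 0 < gamma < PI ->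
  closed_gear beta gamma w -> ~ std_gear beta gamma w ->
  Cmod w = 1 \/ Cmod w = beta \/
  Im (polar 1 (- gamma) * w)%C = 0 \/ Im (polar 1 gamma * w)%C = 0.
Proof.
  intros Hg Hc Hn. rewrite (std_gear_iff _ _ _ Hg) in Hn.
  apply not_or_and in Hn. destruct Hn as [Hn1 Hn2].
  destruct Hc as [Hc|[Hc1 Hc2]]; [left; lra|].
  destruct (Req_dec (Cmod w) beta) as [Hb|Hb]; [auto|].
  right; right.
  assert (E : Cmod w * cos gamma = Re w).
  { apply Rle_antisym; [exact Hc2|]. apply Rnot_lt_le. intros X. apply Hn2. split; lra. }
  assert (E2 : (Re w * sin gamma - Im w * cos gamma) * (Re w * sin gamma + Im w * cos gamma) = 0).
  { assert (P := sin2_cos2 gamma). unfold Rsqr in P.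
    assert (M := Cmod2_alt w).
    replace ((Re w * sin gamma - Im w * cos gamma) * (Re w * sin gamma + Im w * cos gamma))
      with (Re w ^ 2 * (sin gamma * sin gamma + cos gamma * cos gamma)
            - (Re w ^ 2 + Im w ^ 2) * (cos gamma * cos gamma)) by ring.
    rewrite P, <- M, <- E. ring. }
  apply Rmult_integral in E2. destruct E2 as [E2|E2].
  - left. unfold polar, Im, Re in *; simpl. rewrite cos_neg, sin_neg. lra.
  - right. unfold polar, Im, Re in *; simpl. lra.
Qed.

(** * Pigeonhole for sequences *)

(** [P] holds for infinitely many indices. *)
Definition frequently (P : nat -> Prop) : Prop :=
  forall N : nat, exists n : nat, (N <= n)%nat /\ P n.

Lemma frequently_or (P Q : nat -> Prop) :
  frequently (fun n => P n \/ Q n) -> frequently P \/ frequently Q.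
Proof.
  intros H. destruct (classic (frequently P)) as [HP|HP]; [now left|right].
  apply not_all_ex_not in HP. destruct HP as [N0 HN0].
  intros N. destruct (H (N + N0)%nat) as (n & Hn & [K|K]).
  - exfalso. apply HN0. exists n. split; [lia|exact K].
  - exists n. split; [lia|exact K].
Qed.

Lemma frequently_three (P : nat -> Prop) : frequently P ->
  exists i j k : nat, (i < j < k)%nat /\ P i /\ P j /\ P k.
Proof.
  intros H. destruct (H 0%nat) as (i & _ & Hi).
  destruct (H (S i)) as (j & Hij & Hj). destruct (H (S j)) as (k & Hjk & Hk).
  exists i, j, k. repeat split; auto; lia.
Qed.

(** * Moebius transformations and circles *)

(** Three distinct points of a circle centered at the origin lie on no line. *)
Lemma three_points (r k : R) (z p1 p2 p3 : C) :
  Cmod p1 = r -> Cmod p2 = r -> Cmod p3 = r ->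
  p1 <> p2 -> p1 <> p3 -> p2 <> p3 ->
  k + Re (z * p1)%C = 0 -> k + Re (z * p2)%C = 0 -> k + Re (z * p3)%C = 0 ->
  k = 0 /\ z = 0%C.
Proof.
  intros M1 M2 M3 D12 D13 D23 E1 E2 E3.
  assert (Hz : z = 0%C).
  { destruct (Ceq_dec z 0) as [|Hz]; [assumption|exfalso].
    (* |z p| and Re (z p) are the same for the three points, so Im (z p) takes
       at most two values, which are opposite *)
    assert (S : forall p, Cmod p = r -> k + Re (z * p)%C = 0 ->
      Im (z * p)%C ^ 2 = (Cmod z * r) ^ 2 - k ^ 2).
    { intros p Mp Ep. rewrite <- Mp, <- Cmod_mult, Cmod2_alt.
      replace k with (- Re (z * p)%C) by lra. ring. }
    assert (J : forall p q, k + Re (z * p)%C = 0 -> k + Re (z * q)%C = 0 ->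
      Im (z * p)%C = Im (z * q)%C -> p = q).
    { intros p q Ep Eq Ei. assert (X : (z * p)%C = (z * q)%C).
      { apply injective_projections; [|exact Ei]. unfold Re in *. lra. }
      replace p with (z * p / z)%C by (field; exact Hz). rewrite X. field; exact Hz. }
    assert (S1 := S _ M1 E1). assert (S2 := S _ M2 E2). assert (S3 := S _ M3 E3).
    assert (O12 : Im (z * p1)%C + Im (z * p2)%C = 0).
    { assert (X : (Im (z * p1)%C - Im (z * p2)%C) * (Im (z * p1)%C + Im (z * p2)%C) = 0) by nra.
      apply Rmult_integral in X. destruct X as [X|X]; [|exact X].
      exfalso. apply D12, J; auto. lra. }
    assert (O13 : Im (z * p1)%C + Im (z * p3)%C = 0).
    { assert (X : (Im (z * p1)%C - Im (z * p3)%C) * (Im (z * p1)%C + Im (z * p3)%C) = 0) by nra.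
      apply Rmult_integral in X. destruct X as [X|X]; [|exact X].
      exfalso. apply D13, J; auto. lra. }
    apply D23, J; auto. lra. }
  split; [|exact Hz]. rewrite Hz, Cmult_0_l in E1. simpl in E1. lra.
Qed.

Definition distinct3 (p1 p2 p3 : C) : Prop := p1 <> p2 /\ p1 <> p3 /\ p2 <> p3.

(** The identity [|a w + b| = s |c w + d|] on the circle [|w| = r], which says
    that [mobius a b c d] maps this circle to [|w| = s], expressed by comparison
    of coefficients. *)
Definition circle_to_circle (a b c d : C) (r s : R) : Prop :=
  Cmod a ^ 2 * r ^ 2 + Cmod b ^ 2 = s ^ 2 * (Cmod c ^ 2 * r ^ 2 + Cmod d ^ 2) /\
  (a * Cconj b)%C = (RtoC (s ^ 2) * (c * Cconj d))%C.

Lemma circle_to_circle_three (a b c d p1 p2 p3 : C) (r s : R) :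
  distinct3 p1 p2 p3 ->
  (forall p, p = p1 \/ p = p2 \/ p = p3 ->
     Cmod p = r /\ (c * p + d)%C <> 0%C /\ Cmod (mobius a b c d p) = s) ->
  circle_to_circle a b c d r s.
Proof.
  intros (D12 & D13 & D23) H.
  set (k := Cmod a ^ 2 * r ^ 2 + Cmod b ^ 2 - s ^ 2 * (Cmod c ^ 2 * r ^ 2 + Cmod d ^ 2)).
  set (z := (2 * (a * Cconj b - RtoC (s ^ 2) * (c * Cconj d)))%C).
  assert (E : forall p, p = p1 \/ p = p2 \/ p = p3 -> Cmod p = r /\ k + Re (z * p)%C = 0).
  { intros p Hp. destruct (H p Hp) as (Hr & Hd & Hs). split; [exact Hr|].
    unfold mobius in Hs. rewrite Cmod_div in Hs by exact Hd.
    assert (Hd' := proj1 (Cmod_gt_0 _) Hd).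
    assert (X : Cmod (a * p + b)%C ^ 2 = s ^ 2 * Cmod (c * p + d)%C ^ 2).
    { rewrite <- Hs. field. lra. }
    rewrite !Cmod2_alt in X. unfold k, z. rewrite <- Hr, !Cmod2_alt.
    match type of X with ?L = ?R0 => apply Rminus_diag_eq in X end.
    rewrite <- X.
    destruct a, b, c, d, p. unfold Re, Im; simpl. ring. }
  destruct (E p1) as [M1 K1]; [auto|]. destruct (E p2) as [M2 K2]; [auto|].
  destruct (E p3) as [M3 K3]; [auto|].
  destruct (three_points r k z p1 p2 p3) as [Hk Hz]; auto.
  split; [unfold k in Hk; lra|].
  unfold z in Hz.
  assert (Y : (a * Cconj b - RtoC (s ^ 2) * (c * Cconj d))%C = 0%C).
  { destruct (Ceq_dec (a * Cconj b - RtoC (s ^ 2) * (c * Cconj d))%C 0) as [|N]; [assumption|].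
    exfalso. apply (Cmult_neq_0 2 _) in N; [contradiction|].
    intros Q. apply RtoC_inj in Q. lra. }
  replace (a * Cconj b)%C with
    (a * Cconj b - RtoC (s ^ 2) * (c * Cconj d) + RtoC (s ^ 2) * (c * Cconj d))%C by ring.
  rewrite Y. ring.
Qed.

(** Similarly, [mobius a b c d] maps the circle [|w| = r] to the real line:
    [(a w + b) * Cconj (c w + d)] is real for [|w| = r]. *)
Definition circle_to_line (a b c d : C) (r : R) : Prop :=
  Im (a * Cconj c * RtoC (r ^ 2) + b * Cconj d)%C = 0 /\
  (a * Cconj d)%C = (Cconj b * c)%C.

Lemma circle_to_line_three (a b c d p1 p2 p3 : C) (r : R) :
  distinct3 p1 p2 p3 ->
  (forall p, p = p1 \/ p = p2 \/ p = p3 ->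
     Cmod p = r /\ (c * p + d)%C <> 0%C /\ Im (mobius a b c d p) = 0) ->
  circle_to_line a b c d r.
Proof.
  intros (D12 & D13 & D23) H.
  set (k := Im (a * Cconj c * RtoC (r ^ 2) + b * Cconj d)%C).
  set (z := (- Ci * (a * Cconj d - Cconj b * c))%C).
  assert (E : forall p, p = p1 \/ p = p2 \/ p = p3 -> Cmod p = r /\ k + Re (z * p)%C = 0).
  { intros p Hp. destruct (H p Hp) as (Hr & Hd & Hs). split; [exact Hr|].
    assert (X : Im ((a * p + b) * Cconj (c * p + d))%C = 0).
    { replace ((a * p + b) * Cconj (c * p + d))%C
        with (mobius a b c d p * RtoC (Cmod (c * p + d)%C ^ 2))%C
        by (rewrite Cmod2_conj; unfold mobius; field; exact Hd).
      rewrite im_scal_r, Hs. ring. }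
    unfold k, z. rewrite <- Hr, Cmod2_alt, <- X.
    destruct a, b, c, d, p. unfold Re, Im; simpl. ring. }
  destruct (E p1) as [M1 K1]; [auto|]. destruct (E p2) as [M2 K2]; [auto|].
  destruct (E p3) as [M3 K3]; [auto|].
  destruct (three_points r k z p1 p2 p3) as [Hk Hz]; auto.
  split; [exact Hk|].
  replace (a * Cconj d)%C with (Ci * z + Cconj b * c)%C.
  - rewrite Hz. ring.
  - unfold z. destruct a, b, c, d. apply injective_projections; simpl; ring.
Qed.

Lemma Csub_eq (x y : C) : x = y -> (x - y)%C = 0%C.
Proof. intros ->. ring. Qed.

Lemma Cmult_eq_0 (x y : C) : (x * y)%C = 0%C -> x = 0%C \/ y = 0%C.
Proof.
  intros H. destruct (Ceq_dec x 0) as [|Hx]; [auto|].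
  destruct (Ceq_dec y 0) as [|Hy]; [auto|]. now destruct (Cmult_neq_0 _ _ Hx Hy).
Qed.

Lemma Cconj_neq_0 (z : C) : z <> 0%C -> Cconj z <> 0%C.
Proof. intros H. apply Cmod_gt_0. rewrite Cmod_conj. now apply Cmod_gt_0. Qed.

Lemma Cmod_pow2_eq (x y : C) (s : R) :
  Cmod x ^ 2 = s ^ 2 * Cmod y ^ 2 ->
  (x * Cconj x)%C = (RtoC (s ^ 2) * (y * Cconj y))%C.
Proof. intros H. rewrite <- !Cmod2_conj, <- RtoC_mult. now rewrite H. Qed.

(** The hypotheses say that [|a w + b| = s |c w + d|] for all [w], so
    [mobius a b c d] would map the whole plane to one circle. *)
Lemma circle_degenerate (a b c d : C) (s : R) :
  Cmod a ^ 2 = s ^ 2 * Cmod c ^ 2 -> Cmod b ^ 2 = s ^ 2 * Cmod d ^ 2 ->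
  (a * Cconj b)%C = (RtoC (s ^ 2) * (c * Cconj d))%C -> (a * d - b * c)%C = 0%C.
Proof.
  intros HA HB HE. apply Cmod_pow2_eq, Csub_eq in HA. apply Cmod_pow2_eq, Csub_eq in HB.
  assert (HE' := f_equal Cconj HE). apply Csub_eq in HE. apply Csub_eq in HE'.
  rewrite !Cmult_conj, !Cconj_conj, RtoC_conj in HE'.
  assert (X : ((a * d - b * c) * Cconj (a * d - b * c))%C = 0%C).
  { rewrite Cminus_conj, !Cmult_conj.
    transitivity (d * Cconj d * (a * Cconj a - RtoC (s ^ 2) * (c * Cconj c))
      + c * Cconj c * (b * Cconj b - RtoC (s ^ 2) * (d * Cconj d))
      - Cconj c * d * (a * Cconj b - RtoC (s ^ 2) * (c * Cconj d))
      - c * Cconj d * (Cconj a * b - RtoC (s ^ 2) * (Cconj c * d)))%C; [ring|].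
    rewrite HA, HB, HE, HE'. ring. }
  apply Cmult_eq_0 in X. destruct X as [X|X]; [exact X|].
  destruct (Ceq_dec (a * d - b * c) 0) as [|N]; [assumption|].
  now apply Cconj_neq_0 in N.
Qed.

(** A circle mapped to the real line contains the pole and the zero of the
    transformation. *)
Lemma circle_to_line_moduli (a b c d : C) (r : R) :
  0 < r -> (a * d - b * c)%C <> 0%C -> circle_to_line a b c d r ->
  Cmod d ^ 2 = r ^ 2 * Cmod c ^ 2 /\ Cmod b ^ 2 = r ^ 2 * Cmod a ^ 2.
Proof.
  intros Hr Hdet [H2 H1].
  assert (H1' := f_equal Cconj H1). rewrite !Cmult_conj, !Cconj_conj in H1'.
  assert (H2' : (a * Cconj c * RtoC (r ^ 2) + b * Cconj d
    - (Cconj a * c * RtoC (r ^ 2) + Cconj b * d))%C = 0%C).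
  { transitivity (2 * Ci * RtoC (Im (a * Cconj c * RtoC (r ^ 2) + b * Cconj d)))%C.
    - rewrite <- im_alt', Cplus_conj, !Cmult_conj, !Cconj_conj, RtoC_conj. reflexivity.
    - rewrite H2. ring. }
  assert (Hd : Cmod d ^ 2 = r ^ 2 * Cmod c ^ 2).
  { assert (X : ((a * Cconj c - Cconj a * c) * (RtoC (r ^ 2) * (c * Cconj c) - d * Cconj d))%C = 0%C).
    { transitivity (c * Cconj c * (a * Cconj c * RtoC (r ^ 2) + b * Cconj d
        - (Cconj a * c * RtoC (r ^ 2) + Cconj b * d))
        - Cconj c * d * (a * Cconj d - Cconj b * c)
        + c * Cconj d * (Cconj a * d - b * Cconj c))%C; [ring|].
      rewrite H2', H1, H1'. ring. }
    apply Cmult_eq_0 in X. destruct X as [X|X].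
    - exfalso. apply Hdet.
      assert (Y : (b * Cconj d - Cconj b * d)%C = 0%C).
      { transitivity (a * Cconj c * RtoC (r ^ 2) + b * Cconj d
          - (Cconj a * c * RtoC (r ^ 2) + Cconj b * d)
          - RtoC (r ^ 2) * (a * Cconj c - Cconj a * c))%C; [ring|].
        rewrite H2', X. ring. }
      assert (Z : ((a * d - b * c) * (Cconj c * Cconj d))%C = 0%C).
      { transitivity (Cconj c * d * (a * Cconj d - Cconj b * c)
          - c * Cconj c * (b * Cconj d - Cconj b * d))%C; [ring|].
        rewrite H1, Y. ring. }
      apply Cmult_eq_0 in Z. destruct Z as [Z|Z]; [exact Z|].
      destruct (Ceq_dec c 0) as [Hc|Hc].
      + rewrite Hc in H1 |- *. rewrite Cmult_0_r in H1. apply Cmult_eq_0 in H1.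
        destruct H1 as [->|H1]; [ring|].
        destruct (Ceq_dec d 0) as [->|N]; [ring|]. now apply Cconj_neq_0 in N.
      + apply Cmult_eq_0 in Z. destruct Z as [Z|Z]; [now apply Cconj_neq_0 in Hc|].
        destruct (Ceq_dec d 0) as [Hd|N]; [|now apply Cconj_neq_0 in N].
        rewrite Z, Cmult_0_r in H1. symmetry in H1. apply Cmult_eq_0 in H1.
        destruct H1 as [H1|H1]; [|contradiction].
        destruct (Ceq_dec b 0) as [->|N]; [rewrite Hd; ring|]. now apply Cconj_neq_0 in N.
    - apply RtoC_inj. rewrite RtoC_mult, !Cmod2_conj.
      transitivity (RtoC (r ^ 2) * (c * Cconj c)
        - (RtoC (r ^ 2) * (c * Cconj c) - d * Cconj d))%C; [ring|]. rewrite X. ring. }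
  split; [exact Hd|].
  assert (M : (Cmod a * Cmod d) ^ 2 = (Cmod b * Cmod c) ^ 2).
  { rewrite <- (Cmod_conj d), <- Cmod_mult, H1, Cmod_mult, Cmod_conj. reflexivity. }
  rewrite !Rpow_mult_distr, Hd in M.
  assert (Hc : 0 < Cmod c ^ 2).
  { apply pow_lt, Cmod_gt_0. intros Hc. apply Hdet. rewrite Hc in *.
    rewrite Cmod_0 in Hd. replace (r ^ 2 * 0 ^ 2) with 0 in Hd by ring.
    destruct (Ceq_dec d 0) as [->|N]; [ring|].
    apply Cmod_gt_0 in N. nra. }
  nra.
Qed.

(** A Moebius transformation that is finite at the origin, and that maps each of
    the circles [|w| = 1] and [|w| = beta] to a circle [|w| = s] or to a line
    [Im (w1 w) = 0], fixes the origin and infinity.  At most one of the two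
    circles contains the pole, so they are not both mapped to lines; one line and
    one circle, or twice the same circle, contradict the nonzero determinant. *)
Lemma concentric_circles (beta : R) (a b c d w1 w2 : C) (s1 s2 : R) :
  1 < beta -> (a * d - b * c)%C <> 0%C -> d <> 0%C ->
  Cmod w1 = 1 -> Cmod w2 = 1 ->
  circle_to_circle a b c d 1 s1 \/ circle_to_line (w1 * a) (w1 * b) c d 1 ->
  circle_to_circle a b c d beta s2 \/ circle_to_line (w2 * a) (w2 * b) c d beta ->
  0 < s1 -> 0 < s2 ->
  b = 0%C /\ c = 0%C.
Proof.
  intros Hb Hdet Hd Hw1 Hw2 H1 H2 Hs1 Hs2.
  assert (L : forall r w, 0 < r -> Cmod w = 1 -> circle_to_line (w * a) (w * b) c d r ->
    Cmod d ^ 2 = r ^ 2 * Cmod c ^ 2 /\ Cmod b ^ 2 = r ^ 2 * Cmod a ^ 2).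
  { intros r w Hr Hw H. apply circle_to_line_moduli in H; [|exact Hr|].
    - rewrite !Cmod_mult, Hw, !Rmult_1_l in H. exact H.
    - replace (w * a * d - w * b * c)%C with (w * (a * d - b * c))%C by ring.
      apply Cmult_neq_0; [|exact Hdet]. apply Cmod_gt_0. lra. }
  assert (Hd' : 0 < Cmod d ^ 2) by (apply pow_lt; now apply Cmod_gt_0).
  assert (LC : forall r w r' s, 0 < r -> 0 < s -> Cmod w = 1 ->
     circle_to_line (w * a) (w * b) c d r -> circle_to_circle a b c d r' s -> False).
  { intros r w r' s Hr Hs Hw Hl [_ Hc]. destruct (L r w Hr Hw Hl) as [E1 E2].
    assert (M : (Cmod a * Cmod b) ^ 2 = (s ^ 2 * (Cmod c * Cmod d)) ^ 2).
    { rewrite <- (Cmod_conj b), <- Cmod_mult, Hc, !Cmod_mult, Cmod_conj, Cmod_R.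
      rewrite Rabs_pos_eq by (apply pow_le; lra). reflexivity. }
    assert (Hr2 : 0 < r ^ 2) by now apply pow_lt.
    assert (Ha0 : 0 <= Cmod a ^ 2) by apply pow_le, Cmod_ge_0.
    assert (Hc0 : 0 <= Cmod c ^ 2) by apply pow_le, Cmod_ge_0.
    assert (Hs0 : 0 <= s ^ 2) by (apply pow_le; lra).
    assert (Ea : Cmod a ^ 2 = s ^ 2 * Cmod c ^ 2).
    { assert (M' : r ^ 2 * ((Cmod a ^ 2) ^ 2 - (s ^ 2 * Cmod c ^ 2) ^ 2) = 0).
      { replace (r ^ 2 * ((Cmod a ^ 2) ^ 2 - (s ^ 2 * Cmod c ^ 2) ^ 2))
          with (Cmod a ^ 2 * (r ^ 2 * Cmod a ^ 2) - (s ^ 2) ^ 2 * (Cmod c ^ 2 * (r ^ 2 * Cmod c ^ 2)))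
          by ring.
        rewrite <- E1, <- E2.
        transitivity ((Cmod a * Cmod b) ^ 2 - (s ^ 2 * (Cmod c * Cmod d)) ^ 2); [ring|].
        rewrite M. ring. }
      apply Rmult_integral in M'. destruct M' as [M'|M']; [lra|].
      assert (0 <= s ^ 2 * Cmod c ^ 2) by now apply Rmult_le_pos.
      nra. }
    apply Hdet, (circle_degenerate a b c d s); [exact Ea| |exact Hc].
    rewrite E1, E2, Ea. ring. }
  destruct H1 as [H1|H1], H2 as [H2|H2].
  - destruct (Req_dec s1 s2) as [<-|Hs].
    + exfalso. destruct H1 as [A1 E]. destruct H2 as [A2 _].
      assert (Ea : Cmod a ^ 2 = s1 ^ 2 * Cmod c ^ 2).
      { assert (X : (Cmod a ^ 2 - s1 ^ 2 * Cmod c ^ 2) * (beta ^ 2 - 1) = 0) by lra.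
        apply Rmult_integral in X. destruct X as [X|X]; [lra|nra]. }
      apply Hdet, (circle_degenerate a b c d s1); [exact Ea|nra|exact E].
    + destruct H1 as [_ E1]. destruct H2 as [_ E2].
      assert (X : (RtoC (s1 ^ 2 - s2 ^ 2) * (c * Cconj d))%C = 0%C).
      { rewrite RtoC_minus.
        transitivity (RtoC (s1 ^ 2) * (c * Cconj d) - RtoC (s2 ^ 2) * (c * Cconj d))%C; [ring|].
        rewrite <- E1, <- E2. ring. }
      assert (Hc : c = 0%C).
      { apply Cmult_eq_0 in X. destruct X as [X|X].
        - apply RtoC_inj in X. exfalso. apply Hs. nra.
        - apply Cmult_eq_0 in X. destruct X as [X|X]; [exact X|].
          now apply Cconj_neq_0 in Hd. }
      split; [|exact Hc]. rewrite Hc in *.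
      assert (Ha : a <> 0%C) by (intros ->; apply Hdet; ring).
      assert (Y : (a * Cconj b)%C = 0%C) by (rewrite E1; ring).
      apply Cmult_eq_0 in Y. destruct Y as [Y|Y]; [contradiction|].
      rewrite <- (Cconj_conj b), Y. apply RtoC_conj.
  - exfalso. apply (LC beta w2 1 s1); auto; lra.
  - exfalso. apply (LC 1 w1 beta s2); auto; lra.
  - exfalso. destruct (L 1 w1) as [A _]; auto; [lra|].
    destruct (L beta w2) as [B _]; auto; [lra|].
    assert (0 <= Cmod c ^ 2) by apply pow_le, Cmod_ge_0.
    assert (1 < beta ^ 2) by nra. nra.
Qed.

(** The point of the circle [|p| = r] with real part [x] and nonnegative
    imaginary part. *)
Definition circle_point (r x : R) : C := (x, sqrt (r ^ 2 - x ^ 2)).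

Lemma Cmod_circle_point (r x : R) : 0 < r -> - r <= x <= r -> Cmod (circle_point r x) = r.
Proof.
  intros Hr Hx. unfold Cmod, circle_point. simpl fst. simpl snd.
  rewrite pow2_sqrt by nra.
  match goal with |- sqrt ?e = _ => replace e with (r ^ 2) by ring end.
  apply sqrt_pow2. lra.
Qed.

(** If infinitely many points of the circle [|p| = r] are mapped to the union of
    the four curves carrying the boundary of the gear, then the whole circle is
    mapped to one of these curves. *)
Lemma arc_image (beta gamma r : R) (x : nat -> R) (a b c d : C) :
  1 < beta -> 0 < gamma < PI -> (a * d - b * c)%C <> 0%C -> 0 < r ->
  (forall m n, (m < n)%nat -> x m <> x n) -> (forall n, - r <= x n <= r) ->
  (forall n, (c * circle_point r (x n) + d)%C <> 0%C ->
     Cmod (mobius a b c d (circle_point r (x n))) = 1 \/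
     Cmod (mobius a b c d (circle_point r (x n))) = beta \/
     Im (polar 1 (- gamma) * mobius a b c d (circle_point r (x n)))%C = 0 \/
     Im (polar 1 gamma * mobius a b c d (circle_point r (x n)))%C = 0) ->
  exists (s : R) (w : C), 0 < s /\ Cmod w = 1 /\
    (circle_to_circle a b c d r s \/ circle_to_line (w * a) (w * b) c d r).
Proof.
  intros Hb Hg Hdet Hr Hx Hxr H.
  set (p := fun n => circle_point r (x n)). fold p in H.
  assert (Hp : forall i j k, (i < j < k)%nat -> distinct3 (p i) (p j) (p k)).
  { intros i j k Hijk. unfold distinct3, p, circle_point.
    split; [|split]; intros E; apply (f_equal fst) in E; revert E; apply Hx; lia. }
  assert (Hm : forall n, Cmod (p n) = r).
  { intros n. apply Cmod_circle_point; auto. }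
  assert (KC : forall s, frequently (fun n => (c * p n + d)%C <> 0%C /\
      Cmod (mobius a b c d (p n)) = s) -> circle_to_circle a b c d r s).
  { intros s F. apply frequently_three in F. destruct F as (i & j & k & Hijk & Hi & Hj & Hk).
    apply (circle_to_circle_three a b c d (p i) (p j) (p k)); [auto|].
    intros q [->|[->| ->]]; auto. }
  assert (KL : forall w, frequently (fun n => (c * p n + d)%C <> 0%C /\
      Im (w * mobius a b c d (p n))%C = 0) -> circle_to_line (w * a) (w * b) c d r).
  { intros w F. apply frequently_three in F. destruct F as (i & j & k & Hijk & Hi & Hj & Hk).
    apply (circle_to_line_three _ _ c d (p i) (p j) (p k)); [auto|].
    assert (E : forall q, (c * q + d)%C <> 0%C ->
      mobius (w * a) (w * b) c d q = (w * mobius a b c d q)%C).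
    { intros q Hq. unfold mobius. field. exact Hq. }
    intros q [->|[->| ->]]; rewrite E; intuition auto. }
  assert (F : frequently (fun n =>
    (c * p n + d)%C = 0%C \/
    ((c * p n + d)%C <> 0%C /\ Cmod (mobius a b c d (p n)) = 1) \/
    ((c * p n + d)%C <> 0%C /\ Cmod (mobius a b c d (p n)) = beta) \/
    ((c * p n + d)%C <> 0%C /\ Im (polar 1 (- gamma) * mobius a b c d (p n))%C = 0) \/
    ((c * p n + d)%C <> 0%C /\ Im (polar 1 gamma * mobius a b c d (p n))%C = 0))).
  { intros N. exists N. split; [lia|].
    destruct (Ceq_dec (c * p N + d) 0) as [|Hn]; [auto|].
    destruct (H N Hn) as [K|[K|[K|K]]]; tauto. }
  apply frequently_or in F. destruct F as [F|F].
  { exfalso. apply frequently_three in F. destruct F as (i & j & k & Hijk & Hi & Hj & Hk).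
    destruct (Hp i j k Hijk) as (Dij & _ & _).
    assert (X : (c * (p i - p j))%C = 0%C).
    { transitivity (c * p i + d - (c * p j + d))%C; [ring|]. rewrite Hi, Hj. ring. }
    apply Cmult_eq_0 in X. destruct X as [X|X].
    - apply Hdet. rewrite X in *. replace d with (0 * p i + d)%C by ring. rewrite Hi. ring.
    - apply Dij. transitivity (p i - p j + p j)%C; [ring|]. rewrite X. ring. }
  apply frequently_or in F. destruct F as [F|F].
  { exists 1, 1%C. rewrite Cmod_1. split; [lra|]. split; [lra|]. left. now apply KC. }
  apply frequently_or in F. destruct F as [F|F].
  { exists beta, 1%C. rewrite Cmod_1. split; [lra|]. split; [lra|]. left. now apply KC. }
  apply frequently_or in F. destruct F as [F|F].
  - exists 1, (polar 1 (- gamma)). rewrite Cmod_polar by lra. split; [lra|].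
    split; [lra|]. right. now apply KL.
  - exists 1, (polar 1 gamma). rewrite Cmod_polar by lra. split; [lra|].
    split; [lra|]. right. now apply KL.
Qed.

Lemma mobius_inj (a b c d u v : C) :
  (a * d - b * c)%C <> 0%C -> (c * u + d)%C <> 0%C -> (c * v + d)%C <> 0%C ->
  mobius a b c d u = mobius a b c d v -> u = v.
Proof.
  intros Hdet Hu Hv E. unfold mobius in E.
  assert (X : ((a * d - b * c) * (u - v))%C = 0%C).
  { transitivity (((a * u + b) / (c * u + d) - (a * v + b) / (c * v + d))
      * ((c * u + d) * (c * v + d)))%C; [field; auto|].
    rewrite E. ring. }
  apply Cmult_eq_0 in X. destruct X as [X|X]; [contradiction|].
  transitivity (u - v + v)%C; [ring|]. rewrite X. ring.
Qed.

(** A boundary point of the gear that is a radial limit of interior points is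
    mapped to the boundary by an automorphism, unless it is the pole. *)
Lemma radial_boundary (beta gamma : R) (a b c d p : C) :
  0 < gamma < PI -> (a * d - b * c)%C <> 0%C ->
  (forall u, std_gear beta gamma u ->
     (c * u + d)%C <> 0%C /\ std_gear beta gamma (mobius a b c d u)) ->
  (forall v, std_gear beta gamma v ->
     exists u, std_gear beta gamma u /\ mobius a b c d u = v) ->
  (forall x, 0 < x < 1 -> std_gear beta gamma (RtoC x * p)%C) ->
  ~ std_gear beta gamma p -> (c * p + d)%C <> 0%C ->
  closed_gear beta gamma (mobius a b c d p) /\ ~ std_gear beta gamma (mobius a b c d p).
Proof.
  intros Hg Hdet Hin Hsurj Hrad Hp Hpole. split.
  - apply closed_gear_limit; [exact Hg|]. intros eps He.
    destruct (mobius_jet3 a b c d p Hpole) as [HD _].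
    set (l := ((a * d - b * c) / ((c * p + d) * (c * p + d)))%C) in HD.
    destruct (proj1 (is_Cderive_eps _ _ _) HD 1 Rlt_0_1) as (dl & Hdl & K).
    assert (Hl := Cmod_ge_0 l). assert (Hpm := Cmod_ge_0 p).
    set (M := (1 + Cmod l) * (Cmod p + 1)).
    assert (HM : 0 < M) by (unfold M; nra).
    set (h := Rmin (/ 2) (Rmin (dl / (Cmod p + 1)) (eps / M)) / 2).
    assert (H1 : 0 < dl / (Cmod p + 1)) by (apply Rdiv_lt_0_compat; lra).
    assert (H2 : 0 < eps / M) by (apply Rdiv_lt_0_compat; lra).
    assert (Hh : 0 < h /\ h < / 2 /\ h < dl / (Cmod p + 1) /\ h < eps / M).
    { assert (X1 := Rmin_l (/ 2) (Rmin (dl / (Cmod p + 1)) (eps / M))).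
      assert (X2 := Rmin_r (/ 2) (Rmin (dl / (Cmod p + 1)) (eps / M))).
      assert (X3 := Rmin_l (dl / (Cmod p + 1)) (eps / M)).
      assert (X4 := Rmin_r (dl / (Cmod p + 1)) (eps / M)).
      assert (X5 : 0 < Rmin (/ 2) (Rmin (dl / (Cmod p + 1)) (eps / M)))
        by (repeat apply Rmin_glb_lt; lra).
      unfold h. lra. }
    clearbody h. destruct Hh as (Hh0 & Hh1 & Hh2 & Hh3).
    exists (mobius a b c d (RtoC (1 - h) * p)). split; [apply Hin, Hrad; lra|].
    assert (E : Cmod (RtoC (1 - h) * p - p)%C = h * Cmod p).
    { replace (RtoC (1 - h) * p - p)%C with (- (RtoC h * p))%C by (rewrite RtoC_minus; ring).
      rewrite Cmod_opp, Cmod_mult, Cmod_R, Rabs_pos_eq by lra. reflexivity. }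
    specialize (K (RtoC (1 - h) * p)%C). rewrite E in K.
    assert (Hh2' : h * (Cmod p + 1) < dl).
    { apply (Rmult_lt_compat_r (Cmod p + 1)) in Hh2; [|lra].
      replace (dl / (Cmod p + 1) * (Cmod p + 1)) with dl in Hh2 by (field; lra). exact Hh2. }
    assert (Hh3' : h * M < eps).
    { apply (Rmult_lt_compat_r M) in Hh3; [|lra].
      replace (eps / M * M) with eps in Hh3 by (field; lra). exact Hh3. }
    assert (K' := K ltac:(nra)).
    set (D1 := (mobius a b c d (RtoC (1 - h) * p) - mobius a b c d p)%C) in *.
    set (D2 := ((RtoC (1 - h) * p - p) * l)%C) in *.
    replace D1 with ((D1 - D2) + D2)%C by ring.
    eapply Rle_lt_trans; [apply Cmod_triangle|].
    assert (E2 : Cmod D2 = h * Cmod p * Cmod l) by (unfold D2; rewrite Cmod_mult, E; reflexivity).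
    rewrite E2. unfold M in Hh3'. nra.
  - intros Himg. destruct (Hsurj _ Himg) as (u & Hu & E).
    apply Hp. destruct (Hin u Hu) as [Hu' _].
    rewrite <- (mobius_inj a b c d u p Hdet Hu' Hpole E). exact Hu.
Qed.

Lemma RtoC_scal_Re (x : R) (p : C) : Re (RtoC x * p)%C = x * Re p.
Proof. unfold Re; simpl; ring. Qed.

(** Moebius automorphisms of the gear fix the origin and infinity. *)
Lemma gear_automorphism (beta gamma : R) (a b c d : C) :
  1 < beta -> 0 < gamma < PI -> (a * d - b * c)%C <> 0%C ->
  (forall u, std_gear beta gamma u ->
     (c * u + d)%C <> 0%C /\ std_gear beta gamma (mobius a b c d u)) ->
  (forall v, std_gear beta gamma v ->
     exists u, std_gear beta gamma u /\ mobius a b c d u = v) ->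
  b = 0%C /\ c = 0%C.
Proof.
  intros Hb Hg Hdet Hin Hsurj.
  assert (Hcos : -1 < cos gamma < 1).
  { split.
    - rewrite <- cos_PI. apply cos_decreasing_1; lra.
    - rewrite <- cos_0. apply cos_decreasing_1; lra. }
  assert (Hn : forall n, 0 < / (INR n + 1) <= 1).
  { intros n. assert (X := pos_INR n). split; [apply Rinv_0_lt_compat; lra|].
    rewrite <- Rinv_1. apply Rinv_le_contravar; lra. }
  assert (Hmn : forall m n, (m < n)%nat -> / (INR n + 1) < / (INR m + 1)).
  { intros m n Hlt. apply Rinv_lt_contravar.
    - assert (X := pos_INR n). assert (Y := pos_INR m). nra.
    - apply lt_INR in Hlt. lra. }
  assert (BP : forall p, (forall x, 0 < x < 1 -> std_gear beta gamma (RtoC x * p)%C) ->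
    ~ std_gear beta gamma p -> (c * p + d)%C <> 0%C ->
    Cmod (mobius a b c d p) = 1 \/ Cmod (mobius a b c d p) = beta \/
    Im (polar 1 (- gamma) * mobius a b c d p)%C = 0 \/
    Im (polar 1 gamma * mobius a b c d p)%C = 0).
  { intros p H1 H2 H3.
    destruct (radial_boundary beta gamma a b c d p) as [A B]; auto.
    now apply closed_gear_boundary. }
  (* real parts of points on the inner arc: they lie in (-1, cos gamma] *)
  destruct (arc_image beta gamma 1 (fun n => -1 + (1 + cos gamma) * / (INR n + 1)) a b c d)
    as (s1 & w1 & Hs1 & Hw1 & K1); auto; try lra.
  { intros m n Hlt. specialize (Hmn m n Hlt). nra. }
  { intros n. specialize (Hn n). nra. }
  { intros n. specialize (Hn n). set (e := / (INR n + 1)) in *. clearbody e.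
    assert (M : Cmod (circle_point 1 (-1 + (1 + cos gamma) * e)) = 1)
      by (apply Cmod_circle_point; nra).
    apply BP.
    - intros x Hx. left. rewrite Cmod_mult, M, Cmod_R, Rabs_pos_eq; lra.
    - rewrite std_gear_iff, M by exact Hg. unfold Re; simpl. nra. }
  (* real parts of points on the outer arc: they lie in (beta cos gamma, beta) *)
  destruct (arc_image beta gamma beta
    (fun n => beta - beta * (1 - cos gamma) / 2 * / (INR n + 1)) a b c d)
    as (s2 & w2 & Hs2 & Hw2 & K2); auto; try lra.
  { intros m n Hlt. specialize (Hmn m n Hlt).
    assert (0 < beta * (1 - cos gamma) / 2) by nra. nra. }
  { intros n. specialize (Hn n). assert (0 < beta * (1 - cos gamma) <= beta * 2) by nra. nra. }
  { intros n. specialize (Hn n). set (e := / (INR n + 1)) in *. clearbody e.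
    assert (X : 0 < beta * (1 - cos gamma) <= beta * 2) by nra.
    set (y := beta - beta * (1 - cos gamma) / 2 * e).
    assert (Hy : beta * cos gamma < y <= beta) by (unfold y; nra).
    assert (M : Cmod (circle_point beta y) = beta)
      by (apply Cmod_circle_point; nra).
    apply BP.
    - intros x Hx. apply std_gear_iff; [exact Hg|]. right.
      rewrite RtoC_scal_Re, Cmod_mult, M, Cmod_R, Rabs_pos_eq by lra.
      change (Re (circle_point beta y)) with y. split; nra.
    - rewrite std_gear_iff, M by exact Hg. lra. }
  apply (concentric_circles beta a b c d w1 w2 s1 s2); auto.
  destruct (Hin 0%C) as [H0 _].
  { left. rewrite Cmod_0. lra. }
  intros Hd. apply H0. rewrite Hd. ring.
Qed.

(** * Symmetric pregears *)

(** [D] is the image of the standard gear under the Moebius transformation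
    [u -> (A u + B)/(C u + E)], which has no pole there. *)
Definition mobius_image (beta gamma : R) (A B C0 E : C) (D : C -> Prop) : Prop :=
  (A * E - B * C0)%C <> 0%C /\
  (forall u, std_gear beta gamma u -> (C0 * u + E)%C <> 0%C) /\
  (forall w, D w <-> exists u, std_gear beta gamma u /\ w = mobius A B C0 E u).

Lemma std_gear_conj (beta gamma : R) (u : C) : 0 < gamma < PI ->
  std_gear beta gamma u -> std_gear beta gamma (Cconj u).
Proof. intros Hg. rewrite !(std_gear_iff _ _ _ Hg), Cmod_conj, re_conj. auto. Qed.

(** If the image is symmetric then the transformation [M] conjugates the
    reflection in the real line to an anti-Moebius automorphism of the gear, which
    fixes the origin and infinity; the images [B/E] and [A/C0] of these two points
    are therefore real or infinite.  The matrix [(ta, tb; tc, td)] of the proof is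
    the adjugate of the matrix of [M] times its complex conjugate. *)
Lemma mobius_image_symmetric (beta gamma : R) (A B C0 E : C) (D : C -> Prop) :
  1 < beta -> 0 < gamma < PI -> mobius_image beta gamma A B C0 E D ->
  (forall w, D w <-> D (Cconj w)) ->
  (E * Cconj B - B * Cconj E)%C = 0%C /\ (A * Cconj C0 - C0 * Cconj A)%C = 0%C.
Proof.
  intros Hb Hg (Hdet & Hpole & HD) Hsym.
  set (ta := (E * Cconj A - B * Cconj C0)%C).
  set (tb := (E * Cconj B - B * Cconj E)%C).
  set (tc := (A * Cconj C0 - C0 * Cconj A)%C).
  set (td := (A * Cconj E - C0 * Cconj B)%C).
  assert (Hconj : forall u, (C0 * Cconj u + E)%C <> 0%C ->
    (Cconj C0 * u + Cconj E)%C <> 0%C /\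
    Cconj (mobius A B C0 E (Cconj u))
      = ((Cconj A * u + Cconj B) / (Cconj C0 * u + Cconj E))%C).
  { intros u Hu. split.
    - apply Cconj_neq_0 in Hu. rewrite Cplus_conj, Cmult_conj, Cconj_conj in Hu. exact Hu.
    - unfold mobius, Cdiv. autorewrite with conj. now rewrite Cconj_conj. }
  assert (Htau : forall u v, std_gear beta gamma u -> std_gear beta gamma v ->
    Cconj (mobius A B C0 E (Cconj u)) = mobius A B C0 E v ->
    (tc * u + td)%C <> 0%C /\ mobius ta tb tc td u = v).
  { intros u v Hu Hv Huv.
    destruct (Hconj u) as [He Heq]; [apply Hpole; now apply std_gear_conj|].
    rewrite Heq in Huv. unfold mobius in Huv.
    specialize (Hpole v Hv).
    set (n := (Cconj A * u + Cconj B)%C) in *. set (e := (Cconj C0 * u + Cconj E)%C) in *.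
    assert (Hn : n = (e * ((A * v + B) / (C0 * v + E)))%C).
    { rewrite <- Huv. field. exact He. }
    assert (Hden : (tc * u + td)%C = (e * (A * E - B * C0) / (C0 * v + E))%C).
    { transitivity (A * e - C0 * n)%C; [unfold tc, td, n, e; ring|].
      rewrite Hn. field. exact Hpole. }
    assert (Hnum : (ta * u + tb)%C = (e * (A * E - B * C0) * v / (C0 * v + E))%C).
    { transitivity (E * n - B * e)%C; [unfold ta, tb, n, e; ring|].
      rewrite Hn. field. exact Hpole. }
    split.
    - rewrite Hden. apply Cdiv_neq_0; [now apply Cmult_neq_0|exact Hpole].
    - unfold mobius. rewrite Hnum, Hden. field. auto. }
  apply (gear_automorphism beta gamma ta tb tc td Hb Hg).
  - replace (ta * td - tb * tc)%C with ((A * E - B * C0) * Cconj (A * E - B * C0))%C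
      by (rewrite Cminus_conj, !Cmult_conj; unfold ta, tb, tc, td; ring).
    apply Cmult_neq_0; [exact Hdet|now apply Cconj_neq_0].
  - intros u Hu.
    assert (Hw : D (Cconj (mobius A B C0 E (Cconj u)))).
    { apply -> Hsym. apply HD. exists (Cconj u). split; [now apply std_gear_conj|reflexivity]. }
    apply HD in Hw. destruct Hw as (v & Hv & Huv).
    destruct (Htau u v Hu Hv Huv) as [H1 H2]. split; [exact H1|]. now rewrite H2.
  - intros v Hv.
    assert (Hw : D (Cconj (mobius A B C0 E v))).
    { apply -> Hsym. apply HD. now exists v. }
    apply HD in Hw. destruct Hw as (u & Hu & Huv).
    assert (Hu' := std_gear_conj _ _ _ Hg Hu).
    exists (Cconj u). split; [exact Hu'|].
    apply Htau; [exact Hu'|exact Hv|].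
    rewrite Cconj_conj, <- Huv. apply Cconj_conj.
Qed.

Lemma real_of_conj_eq (x y : C) : y <> 0%C -> (y * Cconj x - x * Cconj y)%C = 0%C ->
  (x / y)%C = RtoC (Re (x / y)%C).
Proof.
  intros Hy H.
  assert (E : (x / y)%C = Cconj (x / y)%C).
  { rewrite Cdiv_conj by exact Hy. assert (Hy' := Cconj_neq_0 y Hy).
    transitivity ((y * Cconj x - (y * Cconj x - x * Cconj y)) / (y * Cconj y))%C;
      [|rewrite H]; field; auto. }
  apply (f_equal snd) in E. apply injective_projections; [reflexivity|].
  simpl snd in *. unfold Cconj in E. simpl snd in E. lra.
Qed.

Lemma quadratic_three_roots (a2 a1 a0 r1 r2 r3 : R) :
  r1 < r2 -> r2 < r3 ->
  (forall r, r = r1 \/ r = r2 \/ r = r3 -> a2 * r ^ 2 + a1 * r + a0 = 0) ->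
  a2 = 0 /\ a0 = 0.
Proof.
  intros H12 H23 H.
  assert (E1 := H r1 (or_introl eq_refl)).
  assert (E2 := H r2 (or_intror (or_introl eq_refl))).
  assert (E3 := H r3 (or_intror (or_intror eq_refl))).
  assert (F12 : (r2 - r1) * (a2 * (r1 + r2) + a1) = 0) by lra.
  assert (F13 : (r3 - r1) * (a2 * (r1 + r3) + a1) = 0) by lra.
  apply Rmult_integral in F12. apply Rmult_integral in F13.
  assert (G12 : a2 * (r1 + r2) + a1 = 0) by lra.
  assert (G13 : a2 * (r1 + r3) + a1 = 0) by lra.
  assert (G : a2 * (r3 - r2) = 0) by lra.
  apply Rmult_integral in G. assert (Ha2 : a2 = 0) by lra.
  split; [exact Ha2|]. rewrite Ha2 in *. assert (a1 = 0) by lra. subst a1. lra.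
Qed.

Lemma polar_scal (r theta : R) : polar r theta = (RtoC r * polar 1 theta)%C.
Proof. apply injective_projections; simpl; ring. Qed.

(** The circle containing the image of a segment of a ray from the origin
    passes through the images [B/E] and [A/C0] of the origin and of infinity: on
    the ray, its equation is quadratic in the modulus [r], and the extreme
    coefficients vanish. *)
Lemma tooth_circle_points (beta theta : R) (A B C0 E c : C) (rho : R) :
  1 < beta -> (A * E - B * C0)%C <> 0%C ->
  (forall r, 1 <= r <= beta -> (C0 * polar r theta + E)%C <> 0%C ->
     Cmod (mobius A B C0 E (polar r theta) - c)%C = rho) ->
  C0 <> 0%C /\ E <> 0%C /\ Cmod (A / C0 - c)%C = rho /\ Cmod (B / E - c)%C = rho.
Proof.
  intros Hb Hdet H.
  set (e := polar 1 theta).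
  assert (He : Cmod e = 1) by (apply Cmod_polar; lra).
  assert (He0 : e <> 0%C) by (apply Cmod_gt_0; lra).
  assert (Hrho : 0 <= rho).
  { destruct (Rle_lt_dec 0 rho) as [|Hneg]; [assumption|exfalso].
    assert (P : forall r, 1 <= r <= beta -> (C0 * polar r theta + E)%C = 0%C).
    { intros r Hr. destruct (Ceq_dec (C0 * polar r theta + E) 0) as [|N]; [assumption|].
      specialize (H r Hr N). assert (X := Cmod_ge_0 (mobius A B C0 E (polar r theta) - c)). lra. }
    assert (P1 := P 1 ltac:(lra)). assert (P2 := P beta ltac:(lra)).
    rewrite polar_scal in P1, P2. fold e in P1, P2.
    assert (X : (RtoC (beta - 1) * (C0 * e))%C = 0%C).
    { rewrite RtoC_minus. transitivity (C0 * (beta * e) + E - (C0 * (1 * e) + E))%C; [ring|].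
      rewrite P1, P2. ring. }
    apply Cmult_eq_0 in X. destruct X as [X|X]; [apply RtoC_inj in X; lra|].
    apply Cmult_eq_0 in X. destruct X as [X|X]; [|contradiction].
    apply Hdet. rewrite X in *. replace E with (0 * (1 * e) + E)%C by ring. rewrite P1. ring. }
  set (a2 := Cmod (A - c * C0)%C ^ 2 - rho ^ 2 * Cmod C0 ^ 2).
  set (a0 := Cmod (B - c * E)%C ^ 2 - rho ^ 2 * Cmod E ^ 2).
  set (a1 := 2 * Re ((A - c * C0) * e * Cconj (B - c * E))%C
             - rho ^ 2 * (2 * Re (C0 * e * Cconj E)%C)).
  assert (Hexp : forall (x y : C) (r : R),
    Cmod (x * (RtoC r * e) + y)%C ^ 2
    = Cmod x ^ 2 * r ^ 2 + 2 * Re (x * e * Cconj y)%C * r + Cmod y ^ 2).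
  { intros x y r. replace (Cmod x ^ 2) with (Cmod x ^ 2 * Cmod e ^ 2) by (rewrite He; ring).
    rewrite !Cmod2_alt. destruct x, y, e. unfold Re, Im; simpl. ring. }
  assert (HQ : forall r, 1 <= r <= beta -> (C0 * (RtoC r * e) + E)%C <> 0%C ->
    a2 * r ^ 2 + a1 * r + a0 = 0).
  { intros r Hr Hp. specialize (H r Hr). rewrite polar_scal in H. fold e in H.
    specialize (H Hp). assert (Hp' := proj1 (Cmod_gt_0 _) Hp).
    assert (X : Cmod ((A - c * C0) * (RtoC r * e) + (B - c * E))%C
      = rho * Cmod (C0 * (RtoC r * e) + E)%C).
    { rewrite <- H, <- Cmod_mult. f_equal. unfold mobius. field. exact Hp. }
    apply (f_equal (fun t => t ^ 2)) in X.
    rewrite Rpow_mult_distr, !Hexp in X. unfold a2, a1, a0. lra. }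
  assert (Hpole : forall r s, r <> s ->
    (C0 * (RtoC r * e) + E)%C = 0%C -> (C0 * (RtoC s * e) + E)%C <> 0%C).
  { intros r s Hrs Er Es.
    assert (X : (RtoC (r - s) * (C0 * e))%C = 0%C).
    { rewrite RtoC_minus. transitivity (C0 * (r * e) + E - (C0 * (s * e) + E))%C; [ring|].
      rewrite Er, Es. ring. }
    apply Cmult_eq_0 in X. destruct X as [X|X]; [apply RtoC_inj in X; lra|].
    apply Cmult_eq_0 in X. destruct X as [X|X]; [|contradiction].
    apply Hdet. rewrite X in *. replace E with (0 * (r * e) + E)%C by ring. rewrite Er. ring. }
  (* at most one of four points of the segment is a pole *)
  assert (Hroots : a2 = 0 /\ a0 = 0).
  { set (h := (beta - 1) / 3). assert (Hh : 0 < h) by (unfold h; lra).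
    assert (Hbh : 1 + 3 * h = beta) by (unfold h; field).
    destruct (Ceq_dec (C0 * (RtoC 1 * e) + E) 0) as [P1|P1].
    { apply (quadratic_three_roots a2 a1 a0 (1 + h) (1 + 2 * h) (1 + 3 * h)); try lra.
      intros r Hr. apply HQ; [|apply (Hpole 1)]; try exact P1; lra. }
    destruct (Ceq_dec (C0 * (RtoC (1 + h) * e) + E) 0) as [P2|P2].
    { apply (quadratic_three_roots a2 a1 a0 1 (1 + 2 * h) (1 + 3 * h)); try lra.
      intros r Hr. apply HQ; [|apply (Hpole (1 + h))]; try exact P2; lra. }
    destruct (Ceq_dec (C0 * (RtoC (1 + 2 * h) * e) + E) 0) as [P3|P3].
    { apply (quadratic_three_roots a2 a1 a0 1 (1 + h) (1 + 3 * h)); try lra.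
      intros r Hr. apply HQ; [|apply (Hpole (1 + 2 * h))]; try exact P3; lra. }
    apply (quadratic_three_roots a2 a1 a0 1 (1 + h) (1 + 2 * h)); try lra.
    intros r [->|[->| ->]]; apply HQ; auto; lra. }
  destruct Hroots as [Ha2 Ha0].
  assert (K : forall x y : C, Cmod x ^ 2 - rho ^ 2 * Cmod y ^ 2 = 0 -> Cmod x = rho * Cmod y).
  { intros x y E0. assert (X := Cmod_ge_0 x). assert (Y := Cmod_ge_0 y).
    assert (0 <= rho * Cmod y) by now apply Rmult_le_pos. nra. }
  apply K in Ha2. apply K in Ha0.
  assert (Z : forall x y : C, Cmod (x - c * y)%C = rho * Cmod y -> y = 0%C -> x = 0%C).
  { intros x y E0 ->. rewrite Cmod_0, Rmult_0_r in E0. apply Cmod_eq_0 in E0.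
    transitivity (x - c * 0)%C; [ring|exact E0]. }
  assert (HC : C0 <> 0%C).
  { intros X. apply Hdet. rewrite (Z _ _ Ha2 X), X. ring. }
  assert (HE : E <> 0%C).
  { intros X. apply Hdet. rewrite (Z _ _ Ha0 X), X. ring. }
  assert (W : forall x y : C, y <> 0%C -> Cmod (x - c * y)%C = rho * Cmod y ->
    Cmod (x / y - c)%C = rho).
  { intros x y Hy E0. replace (x / y - c)%C with ((x - c * y) / y)%C by (field; exact Hy).
    rewrite Cmod_div, E0 by exact Hy. apply Cmod_gt_0 in Hy. field. lra. }
  auto.
Qed.

(** Two distinct real points of the circle are [b-] and [b+]; excluding one of
    the two possible orders determines which is which. *)
Lemma bpm_unique (c : C) (rho x0 x1 : R) (plus : bool) :
  Cmod (RtoC x0 - c)%C = rho -> Cmod (RtoC x1 - c)%C = rho -> x0 <> x1 ->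
  bpm c rho plus <> x1 ->
  bpm c rho false < bpm c rho true /\ bpm c rho plus = x0 /\ bpm c rho (negb plus) = x1.
Proof.
  intros H0 H1 Hne Hp.
  assert (K : forall x, Cmod (RtoC x - c)%C = rho ->
    sqrt (rho ^ 2 - Im c ^ 2) = Rabs (x - Re c)).
  { intros x Hx. rewrite <- sqrt_Rsqr_abs. f_equal. rewrite <- Hx, Cmod2_alt.
    unfold Re, Im, Rsqr; simpl. ring. }
  assert (K0 := K _ H0). assert (K1 := K _ H1).
  unfold bpm in *. set (s := sqrt _) in *.
  destruct plus; simpl in *; unfold Rabs in *;
    destruct (Rcase_abs (x0 - Re c)), (Rcase_abs (x1 - Re c)); lra.
Qed.

Lemma pregear_chart_mobius_image (D : C -> Prop) (P : pregear_chart) :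
  same_set D (pregear_set P) ->
  let g := pc_gear P in
  let A := (pc_A P * gc_a g)%C in
  let B := (pc_A P * gc_b g + pc_B P)%C in
  let C0 := (pc_C P * gc_a g)%C in
  let E := (pc_C P * gc_b g + pc_D P)%C in
  mobius_image (gc_beta g) (gc_gamma g) A B C0 E D /\
  forall u, (C0 * u + E)%C = (pc_C P * gear_map g u + pc_D P)%C /\
            mobius A B C0 E u = pc_moebius P (gear_map g u).
Proof.
  intros HD g A B C0 E.
  assert (Eq : forall u, (C0 * u + E)%C = (pc_C P * gear_map g u + pc_D P)%C /\
            mobius A B C0 E u = pc_moebius P (gear_map g u)).
  { intros u. assert (E1 : (C0 * u + E)%C = (pc_C P * gear_map g u + pc_D P)%C)
      by (unfold C0, E, gear_map; ring).
    split; [exact E1|]. unfold mobius, pc_moebius. rewrite E1. f_equal.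
    unfold A, B, gear_map. ring. }
  split; [|exact Eq]. split; [|split].
  - replace (A * E - B * C0)%C with (gc_a g * (pc_A P * pc_D P - pc_B P * pc_C P))%C
      by (unfold A, B, C0, E; ring).
    apply Cmult_neq_0; [apply gc_a_neq0|apply pc_det].
  - intros u Hu. rewrite (proj1 (Eq u)). apply pc_regular. now exists u.
  - intros w. rewrite (HD w). split.
    + intros (v & (u & Hu & ->) & ->). exists u. split; [exact Hu|]. now rewrite (proj2 (Eq u)).
    + intros (u & Hu & ->). exists (gear_map g u). split; [now exists u|apply Eq].
Qed.

(** The pregear center is the image of the center of the gear, and the other
    intersection point of the tooth circles is the image of infinity. *)
Lemma pregear_center_mobius (D : C -> Prop) (c : C) (rho : R) (plus : bool) :
  pregear_center D c rho plus ->
  bpm c rho false < bpm c rho true /\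
  D (RtoC (bpm c rho plus)) /\
  (forall w, D w -> D (Cconj w)) /\
  exists (beta gamma : R) (A B C0 E : C),
    1 < beta /\ 0 < gamma < PI /\ mobius_image beta gamma A B C0 E D /\
    C0 <> 0%C /\ E <> 0%C /\
    (B / E)%C = RtoC (bpm c rho plus) /\ (A / C0)%C = RtoC (bpm c rho (negb plus)).
Proof.
  intros (_ & Hsym & _ & _ & (Hrho & P & theta & HP & Hth & Htooth) & pm1 & p1 & _ & Hreal & Hin).
  destruct (pregear_chart_mobius_image D P HP) as [HM Heq].
  set (g := pc_gear P) in *.
  set (A := (pc_A P * gc_a g)%C) in *. set (B := (pc_A P * gc_b g + pc_B P)%C) in *.
  set (C0 := (pc_C P * gc_a g)%C) in *. set (E := (pc_C P * gc_b g + pc_D P)%C) in *.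
  assert (Hb := gc_beta_gt1 g). assert (Hg := gc_gamma_range g).
  assert (HbD : D (RtoC (bpm c rho plus))) by now apply Hreal.
  destruct (mobius_image_symmetric _ _ _ _ _ _ _ Hb Hg HM Hsym) as [S0 S1].
  assert (HM' := HM). destruct HM' as (Hdet & Hpole & HD).
  destruct (tooth_circle_points (gc_beta g) theta A B C0 E c rho Hb Hdet) as (HC & HE & M1 & M0).
  { intros r Hr Hp. apply Htooth. exists (polar r theta).
    split; [now exists r|]. rewrite <- (proj1 (Heq _)), <- (proj2 (Heq _)). auto. }
  assert (R0 := real_of_conj_eq B E HE S0).
  assert (R1 : (A / C0)%C = RtoC (Re (A / C0)%C)).
  { apply real_of_conj_eq; [exact HC|].
    transitivity (- (A * Cconj C0 - C0 * Cconj A))%C; [ring|]. rewrite S1. ring. }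
  set (x0 := Re (B / E)%C) in *. set (x1 := Re (A / C0)%C) in *.
  destruct (bpm_unique c rho x0 x1 plus) as (Hlt & E0 & E1).
  - now rewrite <- R0.
  - now rewrite <- R1.
  - intros X. apply Hdet.
    transitivity ((A / C0 - B / E) * (C0 * E))%C; [field; auto|].
    rewrite R0, R1, X. ring.
  - intros X. rewrite X, <- R1 in HbD. apply HD in HbD. destruct HbD as (u & Hu & Eu).
    specialize (Hpole u Hu). apply Hdet. unfold mobius in Eu.
    transitivity ((A / C0 - (A * u + B) / (C0 * u + E)) * (C0 * (C0 * u + E)))%C; [field; auto|].
    rewrite <- Eu. ring.
  - split; [exact Hlt|]. split; [exact HbD|]. split; [intros w; apply Hsym|].
    exists (gc_beta g), (gc_gamma g), A, B, C0, E.
    rewrite E0, E1. auto 10.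
Qed.

(** * The gear mapping *)

(** The transformation [(w - B/E)/(e (w - A/C0))] sends the images of the origin
    and of infinity back to these points, hence [D] to a gear. *)
Lemma normalized_pregear_is_gear (beta gamma : R) (A B C0 E e : C) (D : C -> Prop) :
  1 < beta -> 0 < gamma < PI -> mobius_image beta gamma A B C0 E D ->
  C0 <> 0%C -> E <> 0%C -> e <> 0%C ->
  (forall w, D w -> (e * w + - (e * (A / C0)))%C <> 0%C) /\
  is_gear (image (mobius 1 (- (B / E)) e (- (e * (A / C0)))) D).
Proof.
  intros Hb Hg (Hdet & Hpole & HD) HC HE He.
  assert (Hnp : forall u, std_gear beta gamma u ->
    (e * mobius A B C0 E u + - (e * (A / C0)))%C
    = (- (e * (A * E - B * C0)) / (C0 * (C0 * u + E)))%C).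
  { intros u Hu. specialize (Hpole u Hu). unfold mobius. field. auto. }
  assert (Hnp' : forall u, std_gear beta gamma u ->
    (e * mobius A B C0 E u + - (e * (A / C0)))%C <> 0%C).
  { intros u Hu. rewrite (Hnp u Hu). apply Cdiv_neq_0.
    - intros X. apply (Cmult_neq_0 e (A * E - B * C0)); auto.
      transitivity (- - (e * (A * E - B * C0)))%C; [ring|]. rewrite X. ring.
    - apply Cmult_neq_0; auto. }
  split.
  - intros w Hw. apply HD in Hw. destruct Hw as (u & Hu & ->). auto.
  - set (k := (- C0 / (e * E))%C).
    assert (Hk : k <> 0%C).
    { apply Cdiv_neq_0; [|now apply Cmult_neq_0].
      intros X. apply HC. transitivity (- - C0)%C; [ring|]. rewrite X. ring. }
    assert (Hl : forall u, std_gear beta gamma u ->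
      mobius 1 (- (B / E)) e (- (e * (A / C0))) (mobius A B C0 E u) = (k * u + 0)%C).
    { intros u Hu. unfold mobius at 1. rewrite (Hnp u Hu). specialize (Hpole u Hu).
      unfold mobius, k. field. repeat split; auto. }
    exists {| gc_beta := beta; gc_gamma := gamma; gc_a := k; gc_b := 0%C;
              gc_beta_gt1 := Hb; gc_gamma_range := Hg; gc_a_neq0 := Hk |}.
    intros w. unfold gear_set, gear_map, image; simpl. split.
    + intros (v & Hv & ->). apply HD in Hv. destruct Hv as (u & Hu & ->).
      exists u. split; [exact Hu|now apply Hl].
    + intros (u & Hu & ->). exists (mobius A B C0 E u).
      split; [apply HD; now exists u|]. symmetry. now apply Hl.
Qed.

Lemma one_minus_q_neq_0 (q : R) (z : C) : -1 < q < 1 -> disk z ->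
  (- RtoC q * z + 1)%C <> 0%C.
Proof.
  intros Hq Hz X.
  assert (E : Cmod (RtoC q * z)%C = 1).
  { rewrite <- Cmod_1. f_equal. transitivity (1 - (- RtoC q * z + 1))%C; [ring|].
    rewrite X. ring. }
  rewrite Cmod_mult, Cmod_R in E. unfold disk in Hz.
  assert (H := Cmod_ge_0 z). assert (Rabs q < 1) by (apply Rabs_def1; lra).
  assert (H' := Rabs_pos q). nra.
Qed.

Lemma Tq_mobius (q : R) (z : C) : Tq q z = mobius 1 (- RtoC q) (- RtoC q) 1 z.
Proof. unfold Tq, mobius. f_equal; ring. Qed.

Lemma Tq_disk (q : R) (z : C) : -1 < q < 1 -> disk z -> disk (Tq q z).
Proof.
  intros Hq Hz. assert (Hn := one_minus_q_neq_0 q z Hq Hz).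
  rewrite Tq_mobius. unfold mobius, disk in *.
  rewrite Cmod_div by exact Hn. apply Cmod_gt_0 in Hn.
  apply Rmult_lt_reg_r with (Cmod (- RtoC q * z + 1)%C); [exact Hn|].
  unfold Rdiv. rewrite Rmult_assoc, Rinv_l, Rmult_1_r, Rmult_1_l by lra.
  assert (X : Cmod (1 * z + - RtoC q)%C ^ 2 < Cmod (- RtoC q * z + 1)%C ^ 2).
  { assert (Y : Cmod z ^ 2 < 1) by (assert (H := Cmod_ge_0 z); nra).
    rewrite Cmod2_alt in Y. rewrite !Cmod2_alt.
    destruct z as [x y]. unfold Re, Im in *; simpl in *.
    assert (0 < (1 - q * q) * (1 - (x * x + y * y))) by (apply Rmult_lt_0_compat; nra).
    lra. }
  assert (H := Cmod_ge_0 (1 * z + - RtoC q)%C). nra.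
Qed.

Lemma Tq_inverse (q : R) (z : C) : -1 < q < 1 -> disk z -> Tq q (Tq (- q) z) = z.
Proof.
  intros Hq Hz.
  assert (Hn := one_minus_q_neq_0 (- q) z ltac:(lra) Hz).
  assert (Hn' := one_minus_q_neq_0 q _ Hq (Tq_disk (- q) z ltac:(lra) Hz)).
  rewrite Tq_mobius, (Tq_mobius (- q)) in *. unfold mobius in *.
  rewrite RtoC_opp in *.
  assert (Hs : (1 - RtoC q * RtoC q)%C <> 0%C).
  { rewrite <- RtoC_mult, <- RtoC_minus. intros X. apply RtoC_inj in X. nra. }
  set (Q := RtoC q) in *. clearbody Q.
  assert (E1 : (- Q * ((1 * z + - - Q) / (- - Q * z + 1)) + 1)%C
    = ((1 - Q * Q) / (- - Q * z + 1))%C) by (field; exact Hn).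
  rewrite E1. field. auto.
Qed.

Lemma pullback_Tq_eq (q : R) (Q : C -> C) (z : C) : -1 < q < 1 -> disk z ->
  pullback_Tq q Q z =
  (Q (mobius 1 (- RtoC q) (- RtoC q) 1 z)
   * ((1 * 1 - - RtoC q * - RtoC q)
      / ((- RtoC q * z + 1) * (- RtoC q * z + 1))) ^ 2)%C.
Proof.
  intros Hq Hz. unfold pullback_Tq. rewrite Tq_mobius. f_equal. f_equal.
  apply is_Cderive_unique.
  apply (is_derive_ext (mobius 1 (- RtoC q) (- RtoC q) 1)).
  - intros w. symmetry. apply Tq_mobius.
  - apply (mobius_jet3 1 (- RtoC q) (- RtoC q) 1 z (one_minus_q_neq_0 q z Hq Hz)).
Qed.

Lemma solves_ext (Q Q' f f1 f2 f3 : C -> C) :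
  (forall z, disk z -> Q z = Q' z) -> solves Q f f1 f2 f3 -> solves Q' f f1 f2 f3.
Proof.
  intros E [HJ HS]. split; [exact HJ|]. intros z Hz. rewrite <- E by exact Hz. auto.
Qed.

(** A solution with a real initial jet commutes with conjugation if the
    right-hand side of the equation does. *)
Lemma solution_conj (Q f f1 f2 f3 : C -> C) (x0 x1 x2 : R) :
  (forall z, Q (Cconj z) = Cconj (Q z)) -> solves Q f f1 f2 f3 ->
  f 0%C = RtoC x0 -> f1 0%C = RtoC x1 -> f2 0%C = RtoC x2 ->
  forall z, disk z -> f z = Cconj (f (Cconj z)) /\ f1 z = Cconj (f1 (Cconj z)).
Proof.
  intros HQ HS E0 E1 E2 z Hz.
  assert (C0 : Cconj 0%C = 0%C) by apply RtoC_conj.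
  apply (solves_unique Q f f1 f2 f3 _ _ _ _ HS (solves_Cconj Q f f1 f2 f3 HQ HS));
    rewrite ?C0, ?E0, ?E1, ?E2, ?RtoC_conj; auto.
Qed.

Lemma disk_real (x : R) : -1 < x < 1 -> disk (RtoC x).
Proof. intros Hx. unfold disk. rewrite Cmod_R. apply Rabs_def1; lra. Qed.

(** The derivative is real and nowhere zero on [(-1, 1)], so it keeps its sign. *)
Lemma derive_positive (Q f f1 f2 f3 : C -> C) (x : R) :
  solves Q f f1 f2 f3 -> f1 0%C = 1%C ->
  (forall z, disk z -> f1 z = Cconj (f1 (Cconj z))) -> -1 < x < 1 ->
  exists m : R, 0 < m /\ f1 (RtoC x) = RtoC m.
Proof.
  intros [HJ HS] H1 Hconj Hx.
  assert (Hreal : forall y, -1 < y < 1 -> f1 (RtoC y) = RtoC (Re (f1 (RtoC y)))).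
  { intros y Hy. assert (E := Hconj _ (disk_real y Hy)). rewrite RtoC_conj in E.
    apply (f_equal snd) in E. apply injective_projections; [reflexivity|].
    unfold Cconj in E. simpl snd in *. lra. }
  exists (Re (f1 (RtoC x))). split; [|now apply Hreal].
  apply Rnot_le_lt. intros Hneg.
  assert (Hsx : forall s, 0 <= s <= 1 -> -1 < s * x < 1) by (intros s Hs; nra).
  assert (Hpt : forall s, (0 + RtoC s * RtoC x)%C = RtoC (s * x)).
  { intros s. rewrite RtoC_mult. ring. }
  set (u := fun s : R => - Re (f1 (0 + RtoC s * RtoC x)%C)).
  assert (Hnz : forall s, 0 <= s <= 1 -> u s <> 0).
  { intros s Hs E. unfold u in E. rewrite Hpt in E. specialize (Hsx s Hs).
    destruct (HS _ (disk_real _ Hsx)) as [N _]. apply N.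
    rewrite (Hreal _ Hsx). f_equal. lra. }
  assert (Hu1 : 0 < u 1).
  { assert (N := Hnz 1 ltac:(lra)). revert N. unfold u. rewrite Hpt, Rmult_1_l. lra. }
  destruct (IVT_interv u 0 1) as (s & Hs & Es).
  - intros s Hs. apply derivable_continuous_pt.
    destruct (HJ _ (disk_real _ (Hsx s Hs))) as (_ & B & _).
    rewrite <- Hpt in B. destruct (is_derive_along f1 0 (RtoC x) s _ B) as [K _].
    eexists. apply is_derive_Reals. exact (is_derive_opp _ _ _ K).
  - lra.
  - unfold u. rewrite Hpt, Rmult_0_l, H1. simpl. lra.
  - exact Hu1.
  - exact (Hnz s Hs Es).
Qed.

Lemma triple_inj (X : Type) (x y z x' y' z' : X) :
  (x, y, z) = (x', y', z') -> x = x' /\ y = y' /\ z = z'.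
Proof. intros H. now inversion H. Qed.

Theorem proposition3p3
    (t lam : R) (ht : 0 < t < PI / 2)
    (f : C -> C)
    (hf : schwarzian_solution (Rtl t lam) f)
    (hf0 : jet2 f 0%C = (RtoC 0, RtoC 1, RtoC 0))
    (D : C -> Prop)
    (hfD : conformal_onto f D)
    (c : C) (rho : R) (plus : bool)
    (hD : pregear_center D c rho plus) :
  exists q : R,
    -1 < q < 1 /\
    f (RtoC (- q)) = RtoC (bpm c rho plus) /\
    (exists h : C -> C,
        schwarzian_solution (pullback_Tq q (Rtl t lam)) h /\
        jet2 h 0%C = gear_jet f (bpm c rho false) (bpm c rho true) q plus) /\
    (forall h : C -> C,
        schwarzian_solution (pullback_Tq q (Rtl t lam)) h ->
        jet2 h 0%C = gear_jet f (bpm c rho false) (bpm c rho true) q plus ->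
        gear_mapping h /\
        h 0%C = RtoC 0 /\
        exists r : R, 0 < r /\ C_derive h 0%C = RtoC r).
Proof.
  destruct (pregear_center_mobius D c rho plus hD)
    as (Hlt & Hb0 & Hsym & beta & gamma & A & B & C0 & E & Hb & Hg & HM & HC & HE & EB & EA).
  destruct hfD as (Hhol & Hinj & Himg).
  assert (HSf := schwarzian_solution_solves _ _ hf).
  unfold jet2 in hf0. apply triple_inj in hf0. destruct hf0 as (E0 & E1 & E2).
  assert (Hconj := solution_conj _ _ _ _ _ 0 1 0 (Rtl_conj t lam) HSf E0 E1 E2).
  (* the preimage of the center is fixed by conjugation *)
  assert (Hz : exists q, -1 < q < 1 /\ f (RtoC (- q)) = RtoC (bpm c rho plus)).
  { destruct (proj2 (Himg _) Hb0) as (z & Hz & Ez).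
    assert (Hz' : disk (Cconj z)) by (unfold disk; now rewrite Cmod_conj).
    assert (X : Cconj z = z).
    { apply Hinj; auto. rewrite (proj1 (Hconj _ Hz')), Cconj_conj, <- Ez. apply RtoC_conj. }
    assert (Xi : z = RtoC (Re z)).
    { apply (f_equal snd) in X. apply injective_projections; [reflexivity|].
      unfold Cconj in X. simpl snd in *. lra. }
    exists (- Re z). split.
    - unfold disk in Hz. rewrite Xi, Cmod_R in Hz. apply Rabs_def2 in Hz. lra.
    - now rewrite Ropp_involutive, <- Xi. }
  destruct Hz as (q & Hq & Efq). exists q. split; [exact Hq|]. split; [exact Efq|].
  destruct (derive_positive _ _ _ _ _ (- q) HSf E1 (fun z Hz => proj2 (Hconj z Hz)) ltac:(lra))
    as (m & Hm & Em).
  (* with this sign, e (b0 - b1) = b+ - b- in both cases *)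
  set (e := RtoC (if plus then 1 else -1)).
  set (b0 := bpm c rho plus) in *. set (b1 := bpm c rho (negb plus)) in *.
  assert (He : e <> 0%C) by (intros X; apply RtoC_inj in X; destruct plus; lra).
  assert (Hdelta : (1 * (- (e * RtoC b1)) - - RtoC b0 * e)%C
    = RtoC (bpm c rho true - bpm c rho false)).
  { unfold e, b0, b1. rewrite RtoC_minus. destruct plus; simpl negb; ring. }
  destruct (normalized_pregear_is_gear beta gamma A B C0 E e D Hb Hg HM HC HE He) as [HnpD Hgear].
  rewrite EA, EB in Hgear. rewrite EA in HnpD.
  assert (HfD : forall z, disk z -> D (f z)) by (intros z Hz; apply Himg; now exists z).
  assert (HdetL : (1 * (- (e * RtoC b1)) - - RtoC b0 * e)%C <> 0%C).
  { rewrite Hdelta. intros X. apply RtoC_inj in X. lra. }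
  assert (HdetT : (1 * 1 - - RtoC q * - RtoC q)%C <> 0%C).
  { replace (1 * 1 - - RtoC q * - RtoC q)%C with (RtoC (1 - q * q))
      by (rewrite RtoC_minus, RtoC_mult; ring).
    intros X. apply RtoC_inj in X. nra. }
  destruct (solves_mobius_comp (Rtl t lam) f _ _ _ 1 (- RtoC b0) e (- (e * RtoC b1))
    1 (- RtoC q) (- RtoC q) 1 HSf HdetL HdetT) as [h3 Hh].
  { intros z Hz. auto. }
  { intros z Hz. now apply one_minus_q_neq_0. }
  { intros z Hz. rewrite <- Tq_mobius. now apply Tq_disk. }
  apply (solves_ext _ (pullback_Tq q (Rtl t lam))) in Hh;
    [|intros z Hz; symmetry; now apply pullback_Tq_eq].
  set (T := mobius 1 (- RtoC q) (- RtoC q) 1) in *.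
  set (L := mobius 1 (- RtoC b0) e (- (e * RtoC b1))) in *.
  match type of Hh with solves _ _ ?u ?v _ => set (h1 := u) in Hh; set (h2 := v) in Hh end.
  assert (Hd0 : disk 0%C) by (unfold disk; rewrite Cmod_0; lra).
  assert (ET : T 0%C = RtoC (- q)).
  { unfold T, mobius. rewrite RtoC_opp. field. }
  assert (Hjet : (L (f (T 0%C)), h1 0%C, h2 0%C)
    = gear_jet f (bpm c rho false) (bpm c rho true) q plus).
  { assert (Hbb : (RtoC (bpm c rho true) - RtoC (bpm c rho false))%C <> 0%C).
    { rewrite <- RtoC_minus. intros X. apply RtoC_inj in X. lra. }
    assert (Hce : (e * RtoC b0 + - (e * RtoC b1))%C
      = (RtoC (bpm c rho true) - RtoC (bpm c rho false))%C).
    { rewrite <- RtoC_minus, <- Hdelta. ring. }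
    unfold gear_jet, h1, h2. cbv zeta. rewrite ET.
    set (F1 := C_derive f (RtoC (- q))). set (F2 := C_derive (C_derive f) (RtoC (- q))).
    rewrite Efq, Hdelta. unfold L, mobius. rewrite Hce.
    rewrite !RtoC_div, !RtoC_pow, !RtoC_minus, !RtoC_pow, RtoC_mult by
      (try apply pow_nonzero; lra).
    set (bp := RtoC (bpm c rho true)) in *. set (bm := RtoC (bpm c rho false)) in *.
    assert (Hone : (- RtoC q * 0 + 1)%C = 1%C) by ring. rewrite Hone.
    f_equal; [f_equal|].
    - field. exact Hbb.
    - field. exact Hbb.
    - unfold e. destruct plus; field; exact Hbb. }
  split.
  - exists (fun z => L (f (T z))).
    destruct (solves_schwarzian_solution _ _ _ _ _ Hh) as [Hsol Hder].
    split; [exact Hsol|]. rewrite <- Hjet. unfold jet2.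
    destruct (Hder _ Hd0) as [-> ->]. reflexivity.
  - intros h Hhs Hhj. assert (HSh := schwarzian_solution_solves _ _ Hhs).
    rewrite <- Hjet in Hhj. unfold jet2 in Hhj. apply triple_inj in Hhj.
    destruct Hhj as (J0 & J1 & J2).
    assert (Eh : forall z, disk z -> h z = L (f (T z))).
    { intros z Hz. exact (proj1 (solves_unique _ _ _ _ _ _ _ _ _ HSh Hh J0 J1 J2 z Hz)). }
    unfold gear_jet in Hjet. cbv zeta in Hjet. apply triple_inj in Hjet.
    destruct Hjet as (G0 & G1 & _).
    split; [|split].
    + exists (image L D). split; [exact Hgear|]. split; [|split].
      * intros z Hz. apply Hhs, Hz.
      * intros z w Hz Hw Ezw. rewrite !Eh in Ezw by assumption.
        assert (HTz : disk (T z)) by (unfold T; rewrite <- Tq_mobius; now apply Tq_disk).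
        assert (HTw : disk (T w)) by (unfold T; rewrite <- Tq_mobius; now apply Tq_disk).
        apply (mobius_inj 1 (- RtoC q) (- RtoC q) 1 z w HdetT);
          [now apply one_minus_q_neq_0|now apply one_minus_q_neq_0|].
        apply Hinj; auto.
        apply (mobius_inj 1 (- RtoC b0) e (- (e * RtoC b1)) _ _ HdetL); auto.
      * intros w. split.
        -- intros (z & Hz & ->). rewrite Eh by exact Hz. exists (f (T z)).
           split; [|reflexivity]. apply HfD. unfold T. rewrite <- Tq_mobius. now apply Tq_disk.
        -- intros (v & Hv & ->). apply Himg in Hv. destruct Hv as (z & Hz & ->).
           exists (Tq (- q) z).
           assert (Hz' : disk (Tq (- q) z)) by (apply Tq_disk; [lra|exact Hz]).
           split; [exact Hz'|]. rewrite Eh by exact Hz'. unfold T.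
           rewrite <- Tq_mobius, Tq_inverse by assumption. reflexivity.
    + rewrite J0. exact G0.
    + exists ((1 - q ^ 2) / (bpm c rho true - bpm c rho false) * m). split.
      * apply Rmult_lt_0_compat; [apply Rdiv_lt_0_compat|exact Hm]; nra.
      * rewrite J1, G1, Em, RtoC_mult. reflexivity.
Qed.
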